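(* Let $n\ge3$ be odd, $d\in[2n]$ and let $A\in\mathbb{R}^{2n\times n}$ have rank $n$. Then $$\beta_L^{2n-1}=\sum_{\substack{l\in[2n]\\ l\ne d}}\ \sum_{(S,T)\in\mathcal{I}_d^l}\frac{(-1)^{\frac{n+1}{2}+d+l+(l<d)}}{\Psi^n}\,\operatorname{sgn}(S,T)\,\det(A_{Sd,\bullet})\,\det(A_{Td,\bullet})\,\operatorname{perm}(\operatorname{adj}(M)_{S,T})\,\frac{\Omega(x)}{x_d}.$$
   Context: $[2n]=\{1,\dots,2n\}$; $x_1,\dots,x_{2n}$ are positive variables. Put $L=A^T\operatorname{diag}(x_1^{-1},\dots,x_{2n}^{-1})A$, $\beta_L^{2n-1}=\operatorname{tr}((L^{-1}dL)^{2n-1})$, $$M=\begin{pmatrix}\operatorname{diag}(x_1,\dots,x_{2n})&-A\\ A^T&0\end{pmatrix},\qquad \Psi=\det M,$$ and $\Omega(x)=\sum_{i=1}^{2n}(-1)^{i-1}x_i\,dx_1\wedge\dots\wedge\widehat{dx_i}\wedge\dots\wedge dx_{2n}$. For $l\in[2n]\setminus\{d\}$, $\mathcal{I}_d^l$ is the set of pairs $(S,T)$ of subsets of $[2n]\setminus\{l,d\}$ with $|S|=|T|=n-1$ and $S\cap T=\emptyset$, each listed in increasing order. $\operatorname{sgn}(S,T)$ is the sign of the permutation sorting the concatenation of $S$ and $T$ increasingly. $Sd$ denotes the list $S$ with $d$ appended at the end; $B_{I,J}$ is the submatrix of $B$ with rows listed by $I$ and columns listed by $J$ in these orders, and $B_{I,\bullet}$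 selects rows only. $\operatorname{adj}(M)=\det(M)M^{-1}$, $\operatorname{perm}$ is the permanent, and $(l<d)$ is $1$ if $l<d$ and $0$ otherwise. *)

(* Defs.v *)
From HB Require Import structures.
From mathcomp Require Import all_boot all_order all_fingroup all_algebra.
From mathcomp Require Import reals topology normedtype derive.
From mathcomp Require Import ring.
(* Again, so that set0, setIC, etc. refer to finset and not to classical_sets. *)
From mathcomp Require Import finset.

Set Implicit Arguments.
Unset Strict Implicit.
Unset Printing Implicit Defensive.

Import GRing.Theory.
Import numFieldNormedType.Exports.

Local Open Scope ring_scope.

(* The exterior algebra of R^m with generators dx_0, ..., dx_(m-1): an element
   is the family of its coefficients a I on the monomials dx_I, where dx_I is
   the wedge product of the dx_i, i in I, taken in increasing order of i. *)
Definition extalg (R : comNzRingType) (m : nat) : Type :=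
  {ffun {set 'I_m} -> R^o}.

Section ExteriorAlgebra.
Variables (R : comNzRingType) (m : nat).

HB.instance Definition _ :=
  GRing.Lmodule.copy (extalg R m) {ffun {set 'I_m} -> R^o}.

Implicit Types (a b c : extalg R m) (I J K : {set 'I_m}).

(* Number of adjacent transpositions needed to sort the monomial dx_I dx_J. *)
Definition crossings I J : nat := \sum_(i in I) \sum_(j in J) (j < i)%N.

Definition wedge a b : extalg R m :=
  [ffun K : {set 'I_m} => \sum_(I : {set 'I_m} | I \subset K)
     (-1) ^+ crossings I (K :\: I) * (a I * b (K :\: I)) : R^o].

Definition ext1 : extalg R m := [ffun K : {set 'I_m} => (K == set0)%:R : R^o].

Definition dx (i : 'I_m) : extalg R m :=
  [ffun K : {set 'I_m} => (K == [set i])%:R : R^o].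

Lemma crossings0l J : crossings set0 J = 0%N.
Proof. by rewrite /crossings big_set0. Qed.

Lemma crossings0r I : crossings I set0 = 0%N.
Proof. by rewrite /crossings big1 // => i _; rewrite big_set0. Qed.

Lemma crossingsUl I J K : [disjoint I & J] ->
  crossings (I :|: J) K = (crossings I K + crossings J K)%N.
Proof.
move=> dIJ; rewrite /crossings -bigU //=.
by apply: eq_bigl => i; rewrite !inE.
Qed.

Lemma crossingsUr I J K : [disjoint J & K] ->
  crossings I (J :|: K) = (crossings I J + crossings I K)%N.
Proof.
move=> dJK; rewrite /crossings -big_split /=; apply: eq_bigr => i _.
by rewrite -bigU //=; apply: eq_bigl => j; rewrite !inE.
Qed.

Lemma wedgeA : associative wedge.
Proof.
move=> a b c; apply/ffunP => K; rewrite !ffunE.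
under eq_bigr => I _ do rewrite ffunE !mulr_sumr.
under [RHS]eq_bigr => L _ do rewrite ffunE mulr_suml mulr_sumr.
rewrite [RHS](exchange_big_dep (fun I => I \subset K)) /=; last first.
  by move=> L I LK IL; apply: subset_trans IL LK.
apply: eq_bigr => I IK.
rewrite [RHS](reindex_onto (fun J => I :|: J) (fun L => L :\: I)) /=; last first.
  by move=> L /andP[_ IL]; rewrite -{1}(setIidPr IL) setID.
apply: eq_big => [J|J].
  rewrite subUset IK subsetUl andbT /= setDUl setDv set0U subsetD.
  by rewrite (sameP setDidPl eqP).
rewrite subsetD => /andP[JK dJI].
have dIJ : [disjoint I & J] by rewrite disjoint_sym.
have -> : (I :|: J) :\: I = J by rewrite setDUl setDv set0U; apply/setDidPl.
rewrite setDDl crossingsUl //.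
have -> : K :\: I = J :|: (K :\: (I :|: J)).
  apply/setP => i; rewrite !inE; case: (boolP (i \in J)) => [iJ|_] /=.
    by rewrite (disjointFr dJI iJ) (subsetP JK).
  by rewrite orbF.
rewrite crossingsUr; last first.
  by rewrite disjoint_sym; have := subxx (K :\: (I :|: J));
    rewrite -setDDl subsetD => /andP[].
rewrite !exprD; ring.
Qed.

Lemma wedge1l : left_id ext1 wedge.
Proof.
move=> a; apply/ffunP => K; rewrite ffunE (bigD1 set0) ?sub0set //= big1.
  by rewrite ffunE eqxx crossings0l setD0 expr0 !mul1r addr0.
by move=> I /andP[_ /negPf I0]; rewrite ffunE I0 mul0r mulr0.
Qed.

Lemma wedge1r : right_id ext1 wedge.
Proof.
move=> a; apply/ffunP => K; rewrite ffunE (bigD1 K) //= big1.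
  by rewrite ffunE setDv eqxx crossings0r expr0 mul1r mulr1 addr0.
move=> I /andP[IK nIK]; rewrite ffunE setD_eq0.
suff -> : K \subset I = false by rewrite mulr0 mulr0.
by apply: contraNF nIK => KI; rewrite eqEsubset IK.
Qed.

Lemma wedgeDl : left_distributive wedge +%R.
Proof.
move=> a b c; apply/ffunP => K; rewrite !ffunE -big_split /=.
by apply: eq_bigr => I _; rewrite ffunE mulrDl mulrDr.
Qed.

Lemma wedgeDr : right_distributive wedge +%R.
Proof.
move=> a b c; apply/ffunP => K; rewrite !ffunE -big_split /=.
by apply: eq_bigr => I _; rewrite ffunE !mulrDr.
Qed.

Lemma ext1_neq0 : ext1 != 0.
Proof.
by apply/eqP => /ffunP/(_ set0)/eqP; rewrite !ffunE eqxx oner_eq0.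
Qed.

HB.instance Definition _ := GRing.Zmodule_isNzRing.Build (extalg R m)
  wedgeA wedge1l wedge1r wedgeDl wedgeDr ext1_neq0.

Lemma wedge_scalel (k : R) a b : k *: (a * b) = k *: a * b.
Proof.
apply/ffunP => K; rewrite !ffunE scaler_sumr.
by apply: eq_bigr => I _; rewrite ffunE /GRing.scale /=; ring.
Qed.

HB.instance Definition _ :=
  GRing.Lmodule_isLalgebra.Build R (extalg R m) wedge_scalel.

Lemma wedge_scaler (k : R) a b : k *: (a * b) = a * (k *: b).
Proof.
apply/ffunP => K; rewrite !ffunE scaler_sumr.
by apply: eq_bigr => I _; rewrite ffunE /GRing.scale /=; ring.
Qed.

HB.instance Definition _ :=
  GRing.Lalgebra_isAlgebra.Build R (extalg R m) wedge_scaler.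

Lemma dxM i j : dx i * dx j =
  [ffun K : {set 'I_m} =>
     ((i != j) && (K == [set i; j]))%:R * (-1) ^+ (j < i)%N : R^o].
Proof.
apply/ffunP => K; rewrite !ffunE.
have [iK|iK] := boolP ([set i] \subset K); last first.
  rewrite big1 => [|I IK].
    suff -> : (K == [set i; j]) = false by rewrite andbF mul0r.
    by apply: contraNF iK => /eqP ->; rewrite subsetUl.
  rewrite !ffunE; suff -> : (I == [set i]) = false by rewrite mul0r mulr0.
  by apply: contraNF iK => /eqP <-.
rewrite (bigD1 [set i]) //= big1 => [|I /andP[_ /negPf I1]]; last first.
  by rewrite ffunE I1 mul0r mulr0.
rewrite !ffunE eqxx mul1r addr0.
have -> : (K :\ i == [set j]) = (i != j) && (K == [set i; j]).
  rewrite sub1set in iK; apply/eqP/andP => [Kij|[ij /eqP ->]].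
    rewrite -(setD1K iK) Kij; split=> //; apply/eqP => eij.
    by have := set11 j; rewrite -Kij eij !inE eqxx.
  by rewrite setU1K // inE.
have [/andP[ij /eqP ->]|_] := boolP (_ && _); last by rewrite mulr0 mul0r.
by rewrite setU1K ?inE // /crossings !big_set1 mul1r mulr1.
Qed.

Lemma dx_sqr i : dx i * dx i = 0.
Proof. by apply/ffunP => K; rewrite dxM !ffunE eqxx mul0r. Qed.

Lemma dx_anticomm i j : dx i * dx j = - (dx j * dx i).
Proof.
apply/ffunP => K; rewrite !dxM !ffunE eq_sym setUC.
case: (ltngtP i j) => [||/val_inj ->]; rewrite ?eqxx ?mul0r ?oppr0 //;
  by rewrite expr0 expr1 !(mulr1, mulrN1, opprK).
Qed.

End ExteriorAlgebra.

(* The differential at x of a function f of m real variables. *)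
Definition differential (R : realType) (m : nat) (f : 'rV[R]_m -> R)
    (x : 'rV[R]_m) : extalg R m :=
  \sum_(i < m) 'D_(delta_mx 0 i) f x *: dx R i.

Definition permanent (R : comNzRingType) (k : nat) (B : 'M[R]_k) : R :=
  \sum_(s : 'S_k) \prod_(i < k) B i (s i).

(* The sign of the permutation p sorting s into strictly increasing order; p is
   unique when s has no repetition, and the value 0 is junk otherwise. *)
Definition sort_sign (R : nzRingType) (m : nat) (s : seq 'I_m) : R :=
  if [pick p : 'S_(size s) |
        sorted ltn [seq val (tnth (in_tuple s) (p i)) | i : 'I_(size s)]]
  is Some p then (-1) ^+ p else 0.

Section Setting.
Variables (R : realType) (n : nat) (A : 'M[R]_(2 * n, n)).
Implicit Types (x : 'rV[R]_(2 * n)) (d l : 'I_(2 * n)).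

Definition Lmx x : 'M[R]_n :=
  A^T *m diag_mx (\row_i (x 0 i)^-1) *m A.

Definition dLmx x : 'M[extalg R (2 * n)]_n :=
  \matrix_(i, j) differential (fun y => Lmx y i j) x.

(* beta k x is the value at x of the form beta_L^k = tr((L^-1 dL)^k). *)
Definition beta (k : nat) x : extalg R (2 * n) :=
  \tr ((map_mx (in_alg (extalg R (2 * n))) (invmx (Lmx x)) *m dLmx x) ^+ k).

Definition Mmx x : 'M[R]_(2 * n + n) :=
  block_mx (diag_mx x) (- A) A^T 0.

Definition Psi x : R := \det (Mmx x).

Definition adjM x : 'M[R]_(2 * n + n) := \det (Mmx x) *: invmx (Mmx x).

(* Indices start at 0 here, which accounts for the exponent i instead of i - 1.
   The product is taken in increasing order of j. *)
Definition Omega x : extalg R (2 * n) :=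
  \sum_(i < 2 * n)
    ((-1) ^+ i * x 0 i) *: \prod_(j < 2 * n | j != i) dx R j.

Definition index_pairs d l : {set {set 'I_(2 * n)} * {set 'I_(2 * n)}} :=
  [set ST : {set 'I_(2 * n)} * {set 'I_(2 * n)} |
            [&& ST.1 \subset ~: [set l; d], ST.2 \subset ~: [set l; d],
                #|ST.1| == n.-1, #|ST.2| == n.-1 & [disjoint ST.1 & ST.2]]].

(* A set S is listed increasingly by enum S. The default value d in the calls
   to nth below is never reached when #|S| = #|T| = n - 1. *)
Definition A_rows d (S : {set 'I_(2 * n)}) : 'M[R]_n :=
  \matrix_(i < n, j < n) A (nth d (rcons (enum S) d) i) j.

Definition adjM_sub d x (S T : {set 'I_(2 * n)}) : 'M[R]_n.-1 :=
  \matrix_(i < n.-1, j < n.-1)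
    adjM x (lshift n (nth d (enum S) i)) (lshift n (nth d (enum T) j)).

End Setting.

(* Main.v *)
Require Import Defs.
From mathcomp Require Import boolp classical_sets functions.
From mathcomp Require Import reals topology normedtype derive ring.
From mathcomp Require Import all_boot all_order all_fingroup all_algebra.

Set Implicit Arguments.
Unset Strict Implicit.
Unset Printing Implicit Defensive.

Import Order.TTheory GRing.Theory Num.Theory GroupScope.
Import numFieldNormedType.Exports.

Local Open Scope ring_scope.

(** Put p = n - 1, which is even, D = diag(1/x) and
    H = - D A L^-1 A^T D.

    Reduction to one coefficient.  Since dL = - A^T D diag(dx) D A, cyclicity
    of the trace gives beta^(2n-1) = tr ((H diag(dx))^(2n-1)) (beta_dxmx).
    Contraction with the Euler field sum_i x_i d/dx_i sends L^-1 dL to -1, and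
    traces of even powers of a matrix of one-forms vanish, so this contraction
    kills beta^(2n-1) (contract_tr_form_mx).  A form of degree 2n - 1 killed by
    it is a multiple of Omega (beta_Omega), hence it is enough to compute the
    coefficient of the monomial omitting dx_d.  That coefficient is the signed
    sum, over all orderings of the indices other than d, of the cyclic products
    of entries of H (tr_dxmx_coef).  Consecutive indices of an ordering are
    distinct, so H may be replaced by N = D + H, the upper left block of M^-1,
    which agrees with H off the diagonal.

    A combinatorial identity.  For every matrix N indexed by 2p + 1 indices,
    the signed sum of its cyclic products equals, up to a global sign,
      sum_l sum_(S, T) +- det(N_(lT, lS)) perm(N_(S, T)),
    where S and T are disjoint, of size p, and avoid l (sum_pair_term).  To see
    this, sum over all arrangements t of the indices into an index l and two
    lists S and T; every triple then occurs p!^2 times.  Expanding perm, and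
    absorbing its permutation into t, and then det, leaves a combination of
    sums relabel_sum N f = sum_t sgn(t) prod_u N (t u) (t (f u)), where f runs
    over the permutations zigzag s of the positions, for s a permutation of
    p + 1 blocks.  Conjugating f by g multiplies relabel_sum N f by sgn(g).
    If s is not a full cycle, then zigzag s has an orbit of even size; rotating
    this orbit is an odd permutation that commutes with zigzag s, so the sum is
    zero (relabel_sum_even_orbit).  The p! full cycles s are conjugate to each
    other by permutations that move the positions of S and those of T
    simultaneously, hence evenly, so they all contribute the same amount, which
    is the sum of cyclic products up to the sign of a perfect shuffle.

    Minors.  By the complementary minor formula for M and its inverse,
    Psi det(N_(lT, lS)) = det(A_(Sd)) det(A_(Td)) (minor_pair), while
    perm(adj(M)_(S, T)) = Psi^p perm(N_(S, T)). *)

(** * Permutations extended along an injection *)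

Section ExtPerm.
Variables (T1 T2 : finType) (j : T1 -> T2) (jI : injective j).
Implicit Types (s : {perm T1}) (x : T2) (a b : T1).

(** The extension of a permutation s along j: it maps j a to j (s a) and fixes
    every point outside the image of j. *)
Definition ext_fun s x := if [pick a | j a == x] is Some a then j (s a) else x.

Lemma ext_fun_in s a : ext_fun s (j a) = j (s a).
Proof.
rewrite /ext_fun; case: pickP => [b /eqP/jI->//|/(_ a)].
by rewrite eqxx.
Qed.

Lemma ext_fun_out s x : (forall a, j a != x) -> ext_fun s x = x.
Proof. by rewrite /ext_fun; case: pickP => // a ja /(_ a); rewrite ja. Qed.

Variant ext_spec s x : T2 -> Prop :=
 | ExtIn a of x = j a : ext_spec s x (j (s a))
 | ExtOut of (forall a, j a != x) : ext_spec s x x.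

Lemma ext_funP s x : ext_spec s x (ext_fun s x).
Proof.
case: (pickP (fun a => j a == x)) => [a /eqP<-|no].
  by rewrite ext_fun_in; constructor.
by rewrite ext_fun_out => [|a]; [constructor=> a|]; rewrite no.
Qed.

Lemma ext_fun_inj s : injective (ext_fun s).
Proof.
move=> x y; case: ext_funP => [a ->|nx]; case: ext_funP => [b ->|ny] //.
- by move/jI/perm_inj->.
- by move=> e; case/eqP: (ny (s a)).
- by move=> e; case/eqP: (nx (s b)); rewrite e.
Qed.

Definition ext_perm s : {perm T2} := perm (@ext_fun_inj s).

Lemma ext_permE s a : ext_perm s (j a) = j (s a).
Proof. by rewrite permE ext_fun_in. Qed.

Lemma ext_perm_out s x : (forall a, j a != x) -> ext_perm s x = x.
Proof. by move=> nx; rewrite permE ext_fun_out. Qed.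

Lemma ext_permM s1 s2 : ext_perm (s1 * s2)%g = (ext_perm s1 * ext_perm s2)%g.
Proof.
apply/permP => x; rewrite permM.
have [[a ->]|nx] : (exists a, x = j a) \/ (forall a, j a != x).
  by case: (ext_funP s1 x) => [a|]; [left; exists a|right].
  by rewrite !ext_permE permM.
by rewrite !ext_perm_out.
Qed.

Lemma ext_perm1 : ext_perm 1%g = 1%g.
Proof.
apply/permP => x; rewrite permE perm1.
by case: ext_funP => // a ->; rewrite perm1.
Qed.

Lemma ext_tperm a b : ext_perm (tperm a b) = tperm (j a) (j b).
Proof.
apply/permP => x; rewrite permE; case: ext_funP => [c ->|nx].
  by rewrite (inj_tperm _ _ _ jI).
by rewrite tpermD.
Qed.

Lemma odd_ext_perm s : odd_perm (ext_perm s) = s.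
Proof.
case: (prod_tpermP s) => ts -> _; elim: ts => [|ab ts IH].
  by rewrite !big_nil ext_perm1 !odd_perm1.
by rewrite !big_cons ext_permM !odd_permM IH ext_tperm !odd_tperm inj_eq.
Qed.

End ExtPerm.

(** * Sums over permutations split by one value *)

Section LiftSum.

Lemma lift_permP n (i a : 'I_n.+1) (s : 'S_n.+1) : s i = a ->
  exists s', s = lift_perm i a s'.
Proof.
move=> sia.
have neq k : s (lift i k) != a.
  by rewrite -sia (inj_eq perm_inj) eq_sym neq_lift.
pose g k := odflt k (unlift a (s (lift i k))).
have gE k : lift a (g k) = s (lift i k).
  by rewrite /g; case: unliftP (neq k) => [k' ->|->]; rewrite ?eqxx.
have gI : injective g.
  by move=> k1 k2 /(congr1 (lift a)); rewrite !gE => /perm_inj/lift_inj.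
exists (perm gI); apply/permP => u.
case: (unliftP i u) => [k|] ->; first by rewrite lift_perm_lift permE gE.
by rewrite lift_perm_id.
Qed.

Lemma lift_perm_inj n (i a : 'I_n.+1) : injective (lift_perm i a).
Proof.
move=> s1 s2 e; apply/permP => k.
by have /permP/(_ (lift i k)) := e; rewrite !lift_perm_lift => /lift_inj.
Qed.

Lemma sum_lift_perm (V : nmodType) n (i : 'I_n.+1) (F : 'S_n.+1 -> V) :
  \sum_s F s = \sum_a \sum_(s : 'S_n) F (lift_perm i a s).
Proof.
rewrite (partition_big (fun s : 'S_n.+1 => s i) predT) //=.
apply: eq_bigr => a _.
have -> : \sum_(s : 'S_n.+1 | s i == a) F s =
          \sum_(s in [set lift_perm i a s | s : 'S_n]) F s.
  apply: eq_bigl => s; apply/eqP/imsetP => [/lift_permP[s' ->]|[s' _ ->]].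
    by exists s'.
  by rewrite lift_perm_id.
rewrite big_imset /=; first by apply: eq_bigl => s; rewrite inE.
by move=> s1 s2 _ _; apply: lift_perm_inj.
Qed.

End LiftSum.

(** * Signed sums over relabellings *)

Section CycSum.
Variables (R : numDomainType) (T : finType) (N : T -> T -> R).
Implicit Types f g r t : {perm T}.

(** The signed sum, over all relabellings t, of the product of the entries of N
    along the edges u -> f u of the functional graph of f.  When f is a full
    cycle these are the cyclic products of N. *)
Definition relabel_sum f :=
  \sum_(t : {perm T}) (-1) ^+ t * \prod_u N (t u) (t (f u)).

Lemma relabel_sum_conj f g : relabel_sum (f ^ g)%g = (-1) ^+ g * relabel_sum f.
Proof.
rewrite /relabel_sum (reindex_inj (mulgI g^-1%g)) /= mulr_sumr.
apply: eq_bigr => t _; rewrite mulrA odd_permM odd_permV signr_addb.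
congr (_ * _); rewrite (reindex_inj (@perm_inj _ g)) /=.
by apply: eq_bigr => u _; rewrite permJ !permM !permK.
Qed.

(** An odd symmetry r of f pairs the terms of t and of r t, with opposite
    signs. *)
Lemma relabel_sum_odd f r : commute f r -> odd_perm r -> relabel_sum f = 0.
Proof.
move=> fr or; have := relabel_sum_conj f r.
rewrite conjgE fr mulKg or expr1 mulN1r => /eqP.
by rewrite -subr_eq0 opprK -mulr2n mulrn_eq0 /= => /eqP.
Qed.

(** The cyclic rotation i |-> i + 1 modulo n + 1. *)
Definition rot_perm n : 'S_n.+1 := lift_perm ord_max ord0 1.

Lemma odd_rot_perm n : odd_perm (rot_perm n) = odd n.
Proof. by rewrite odd_lift_perm odd_perm1 /= !addbF. Qed.

Lemma rot_permE n (i : 'I_n.+1) : rot_perm n i = (i.+1 %% n.+1)%N :> nat.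
Proof.
rewrite /rot_perm; case: (unliftP ord_max i) => [i'|] ->.
  by rewrite lift_perm_lift perm1 !lift0 lift_max modn_small ?ltnS ?ltn_ord.
by rewrite lift_perm_id /= modnn.
Qed.

Lemma rot_perm_max n : rot_perm n ord_max = ord0.
Proof. by rewrite /rot_perm lift_perm_id. Qed.

Lemma rot_perm_widen n (i : 'I_n) :
  rot_perm n (widen_ord (leqnSn n) i) = lift ord0 i.
Proof.
have -> : widen_ord (leqnSn n) i = lift ord_max i.
  by apply: val_inj; rewrite /= /bump leqNgt ltn_ord.
by rewrite /rot_perm lift_perm_lift perm1.
Qed.

Lemma iter_rot f x n (i : 'I_n.+1) : (f ^+ n.+1)%g x = x ->
  (f ^+ (rot_perm n i))%g x = f ((f ^+ i)%g x).
Proof.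
move=> fn; rewrite -permM -expgSr rot_permE.
case: (ltngtP i.+1 n.+1) => [lt|gt|->]; first by rewrite modn_small.
  by move: gt; rewrite ltnNge ltn_ord.
by rewrite modnn fn expg0 perm1.
Qed.

Lemma porbit_pow_inj f x n : n = #|porbit f x| ->
  injective (fun a : 'I_n => (f ^+ a)%g x).
Proof.
move=> En a b; rewrite !permX => eab; apply: val_inj; apply/eqP.
have := uniq_traject_porbit f x; rewrite -En => ut.
rewrite -(nth_uniq x _ _ ut) ?size_traject ?ltn_ord //.
by rewrite !nth_traject ?ltn_ord // eab.
Qed.

Lemma porbit_pow_id f x : (f ^+ #|porbit f x|)%g x = x.
Proof. by rewrite permX iter_porbit. Qed.

Lemma porbit_powP f x n y : n = #|porbit f x| -> y \in porbit f x ->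
  exists a : 'I_n, y = (f ^+ a)%g x.
Proof.
move=> En; rewrite porbit_traject -En => /trajectP[i lt ->].
by exists (Ordinal lt); rewrite permX.
Qed.

(** The permutation that agrees with f on an even orbit and is the identity
    elsewhere is an odd symmetry of f. *)
Lemma relabel_sum_even_orbit f x : ~~ odd #|porbit f x| -> relabel_sum f = 0.
Proof.
move=> ev; case E: #|porbit f x| ev => [|n] /=.
  by have /eqP := card_porbit_neq0 f x.
rewrite negbK => on.
have jI := porbit_pow_inj (esym E); have fn := porbit_pow_id f x.
rewrite E in fn.
apply: (@relabel_sum_odd f (ext_perm jI (rot_perm n))); last first.
  by rewrite odd_ext_perm odd_rot_perm.
apply/permP => y; rewrite !permM.
have [yo|yo] := boolP (y \in porbit f x).
  have [a ->] := porbit_powP (esym E) yo.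
  by rewrite ext_permE iter_rot // -iter_rot // (ext_permE jI) -iter_rot.
have out z : z \notin porbit f x -> forall a : 'I_n.+1, (f ^+ a)%g x != z.
  by move=> zo a; apply: contraNneq zo => <-; rewrite mem_porbit.
rewrite (ext_perm_out _ _ (out _ yo)) ext_perm_out //.
apply: out; apply: contra yo; rewrite -!eq_porbit_mem.
by have := porbit_perm f 1 y; rewrite expg1 => ->.
Qed.

End CycSum.

(** * Positions and zigzag permutations *)

Section Cycles.

(** A set of points that f flips along an orbit contains exactly half of that
    orbit. *)
Lemma orbit_even (T : finType) (f : {perm T}) x (b : pred T) :
  {in porbit f x, forall u, b (f u) = ~~ b u} -> ~~ odd #|porbit f x|.
Proof.
move=> flip; set O := porbit f x.
have fO u : u \in O -> f u \in O.
  rewrite -!eq_porbit_mem; have := porbit_perm f 1 u.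
  by rewrite expg1 => ->.
have le1 : (#|[set u in O | b u]| <= #|[set u in O | ~~ b u]|)%N.
  rewrite -(card_imset _ (@perm_inj _ f)) subset_leq_card //.
  apply/subsetP => _ /imsetP[u + ->]; rewrite !inE => /andP[uO bu].
  by rewrite fO // flip // bu.
have le2 : (#|[set u in O | ~~ b u]| <= #|[set u in O | b u]|)%N.
  rewrite -(card_imset _ (@perm_inj _ f)) subset_leq_card //.
  apply/subsetP => _ /imsetP[u + ->]; rewrite !inE => /andP[uO bu].
  by rewrite fO // flip // bu.
have e : #|[set u in O | b u]| = #|[set u in O | ~~ b u]|.
  by apply/eqP; rewrite eqn_leq le1 le2.
have -> : #|O| = (#|[set u in O | b u]| + #|[set u in O | ~~ b u]|)%N.
  rewrite -(cardsID [set u | b u] O); congr (_ + _)%N; apply: eq_card => u;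
    by rewrite !inE // andbC.
by rewrite e addnn odd_double.
Qed.

Lemma rot_perm_nat n (c d : 'I_n.+1) : d = c.+1 :> nat -> rot_perm n c = d.
Proof.
move=> e; apply: ord_inj; rewrite rot_permE e modn_small //.
by rewrite -e ltn_ord.
Qed.

(** The conjugating permutation is a i = s^i 0. *)
Lemma full_cycle_conj n (s : 'S_n.+1) : #|porbit s ord0| = n.+1 ->
  exists2 a : 'S_n.+1, a ord0 = ord0 & s = (rot_perm n ^ a)%g.
Proof.
move=> E; have aI := porbit_pow_inj (esym E).
have fn := porbit_pow_id s ord0; rewrite E in fn.
have aE (c : 'I_n.+1) : perm aI c = (s ^+ c)%g ord0 by rewrite permE.
exists (perm aI); first by rewrite aE expg0 perm1.
apply/permP => y; rewrite -(permKV (perm aI) y) permJ.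
by rewrite !aE iter_rot.
Qed.

Lemma rot_conj_inj n (a b : 'S_n.+1) : a ord0 = ord0 -> b ord0 = ord0 ->
  (rot_perm n ^ a)%g = (rot_perm n ^ b)%g -> a = b.
Proof.
move=> a0 b0 e; apply/permP => -[m lt]; elim: m lt => [|m IH] lt.
  have -> : Ordinal lt = ord0 by apply: val_inj.
  by rewrite a0 b0.
have lt' := ltnW lt.
rewrite -(@rot_perm_nat _ (Ordinal lt') (Ordinal lt)) //.
by rewrite -[in LHS]permJ -[in RHS]permJ e IH.
Qed.

End Cycles.

Section Positions.
Variable p : nat.
Notation K := (p + p).+1.
Implicit Types (i j : 'I_p) (u : 'I_K) (s : 'S_p.+1).

(** The 2p + 1 positions of an arrangement of an index l and two lists S and T:
    position 0 for l, then those of S, then those of T. *)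
Definition S_pos i : 'I_K := lift ord0 (lshift p i).
Definition T_pos i : 'I_K := lift ord0 (rshift p i).
(** Positions of the lists l, S and l, T, with l in front. *)
Definition lS_pos (a : 'I_p.+1) : 'I_K := oapp S_pos ord0 (unlift ord0 a).
Definition lT_pos (a : 'I_p.+1) : 'I_K := oapp T_pos ord0 (unlift ord0 a).

Lemma lS_pos0 : lS_pos ord0 = ord0. Proof. by rewrite /lS_pos unlift_none. Qed.
Lemma lT_pos0 : lT_pos ord0 = ord0. Proof. by rewrite /lT_pos unlift_none. Qed.
Lemma lS_posS i : lS_pos (lift ord0 i) = S_pos i.
Proof. by rewrite /lS_pos liftK. Qed.
Lemma lT_posS i : lT_pos (lift ord0 i) = T_pos i.
Proof. by rewrite /lT_pos liftK. Qed.

Lemma S_pos_inj : injective S_pos.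
Proof. by move=> i j /lift_inj/lshift_inj. Qed.
Lemma T_pos_inj : injective T_pos.
Proof. by move=> i j /lift_inj/rshift_inj. Qed.

Lemma val_lS_pos (a : 'I_p.+1) : val (lS_pos a) = a.
Proof. by case: (unliftP ord0 a) => [i|] ->; rewrite ?lS_pos0 ?lS_posS. Qed.

Lemma lS_pos_inj : injective lS_pos.
Proof. by move=> a b /(congr1 val); rewrite !val_lS_pos => /val_inj. Qed.

Lemma S_pos_neqT i j : S_pos i != T_pos j.
Proof. by rewrite (inj_eq lift_inj) eq_lrshift. Qed.

Lemma lS_pos_neqT a j : lS_pos a != T_pos j.
Proof.
case: (unliftP ord0 a) => [i|] ->; first by rewrite lS_posS S_pos_neqT.
by rewrite lS_pos0 neq_lift.
Qed.

Lemma lT_pos_neqS a j : lT_pos a != S_pos j.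
Proof.
case: (unliftP ord0 a) => [i|] ->; first by rewrite lT_posS eq_sym S_pos_neqT.
by rewrite lT_pos0 neq_lift.
Qed.

Variant pos_spec : 'I_K -> Prop :=
 | PosT a : pos_spec (lT_pos a)
 | PosS i : pos_spec (S_pos i).

Lemma posP u : pos_spec u.
Proof.
case: (unliftP ord0 u) => [v|] ->; last by rewrite -lT_pos0; constructor.
rewrite -(splitK v); case: (split v) => i /=; first exact: PosS.
by rewrite -/(T_pos i) -lT_posS; constructor.
Qed.

Lemma big_pos (R : comPzRingType) (F : 'I_K -> R) :
  \prod_u F u = (\prod_a F (lT_pos a)) * \prod_i F (S_pos i).
Proof.
rewrite big_ord_recl big_split_ord /= [in RHS]big_ord_recl lT_pos0 -mulrA.
congr (_ * _); rewrite mulrC; congr (_ * _).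
by apply: eq_bigr => i _; rewrite lT_posS.
Qed.

(** The exchange of the positions of S_i and T_i. *)
Definition swap_fun (v : 'I_(p + p)) : 'I_(p + p) :=
  match split v with inl i => rshift p i | inr i => lshift p i end.

Lemma swap_funl i : swap_fun (lshift p i) = rshift p i.
Proof. by rewrite /swap_fun (unsplitK (inl i)). Qed.

Lemma swap_funr i : swap_fun (rshift p i) = lshift p i.
Proof. by rewrite /swap_fun (unsplitK (inr i)). Qed.

Lemma swap_funK : involutive swap_fun.
Proof.
move=> v; rewrite -(splitK v); case: (split v) => i /=.
  by rewrite swap_funl swap_funr.
by rewrite swap_funr swap_funl.
Qed.

Definition swap_perm : 'S_(p + p) := perm (inv_inj swap_funK).

Definition swap_pos : 'S_K := lift_perm ord0 ord0 swap_perm.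

Lemma swap_pos_lT a : swap_pos (lT_pos a) = lS_pos a.
Proof.
case: (unliftP ord0 a) => [i|] ->.
  by rewrite lT_posS lS_posS lift_perm_lift permE swap_funr.
by rewrite lT_pos0 lS_pos0 lift_perm_id.
Qed.

Lemma swap_pos_s i : swap_pos (S_pos i) = T_pos i.
Proof. by rewrite lift_perm_lift permE swap_funl. Qed.

Lemma lT_pos_inj : injective lT_pos.
Proof.
by move=> a b /(congr1 swap_pos); rewrite !swap_pos_lT => /lS_pos_inj.
Qed.

(** A permutation s of p + 1 blocks, block 0 being l and block i + 1 being the
    pair (S_i, T_i), yields the permutation of the positions that sends S_i to
    T_i inside each pair, and the l or T end of block a to the l or S end of
    block s a. *)
Definition zigzag s : 'S_K := (swap_pos * ext_perm lS_pos_inj s)%g.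

Lemma zigzag_t s a : zigzag s (lT_pos a) = lS_pos (s a).
Proof. by rewrite permM swap_pos_lT ext_permE. Qed.

Lemma zigzag_s s i : zigzag s (S_pos i) = T_pos i.
Proof.
by rewrite permM swap_pos_s ext_perm_out // => a; apply: lS_pos_neqT.
Qed.

Lemma zigzag_lS s a : a != ord0 -> zigzag s (lS_pos a) = lT_pos a.
Proof.
by case: (unliftP ord0 a) => [i|] -> //; rewrite lS_posS lT_posS zigzag_s.
Qed.

Lemma val_S_pos i : val (S_pos i) = i.+1. Proof. by []. Qed.
Lemma val_T_pos i : val (T_pos i) = (p + i).+1. Proof. by []. Qed.

(** A block outside the cycle of s through l gives an orbit on which S and T
    alternate. *)
Lemma zigzag_orbit_even s : #|porbit s ord0| != p.+1 ->
  exists x, ~~ odd #|porbit (zigzag s) x|.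
Proof.
move=> nfull.
have [a0 na0] : exists a, a \notin porbit s ord0.
  apply/existsP; rewrite -negb_forall; apply: contra nfull => /forallP all.
  by rewrite (eq_card (B := predT)) ?card_ord // => a; rewrite all.
exists (lT_pos a0).
pose Q u := exists2 a, a \notin porbit s ord0 & u = lT_pos a \/ u = lS_pos a.
have step a : a \notin porbit s ord0 -> s a \notin porbit s ord0.
  apply: contra; rewrite -!eq_porbit_mem.
  by have := porbit_perm s 1 a; rewrite expg1 => ->.
have neq0 a : a \notin porbit s ord0 -> a != ord0.
  by apply: contraNneq => ->; rewrite porbit_id.
have QO u : u \in porbit (zigzag s) (lT_pos a0) -> Q u.
  case/porbitP => m ->; elim: m => [|m [a na IH]].
    by rewrite expg0 perm1; exists a0 => //; left.
  rewrite expgSr permM; case: IH => ->.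
    by rewrite zigzag_t; exists (s a); [apply: step|right].
  by rewrite zigzag_lS ?neq0 //; exists a => //; left.
(* The positions u > p are those of T. *)
apply: (orbit_even (b := fun u : 'I_K => (p < u)%N)) => u /QO[a na].
have ltbt c : c \notin porbit s ord0 -> (p < lT_pos c)%N.
  move/neq0; case: (unliftP ord0 c) => [i|] -> // _.
  by rewrite lT_posS val_T_pos ltnS leq_addr.
have lebs c : (p < lS_pos c)%N = false.
  case: (unliftP ord0 c) => [i|] ->; last by rewrite lS_pos0.
  by rewrite lS_posS val_S_pos ltnS leqNgt ltn_ord.
by case=> ->; rewrite ?zigzag_t ?zigzag_lS ?neq0 // lebs ltbt.
Qed.

(** For a fixing block 0, the permutation moving S_i and T_i simultaneously.
    It is even, as a product of two permutations of the same sign. *)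
Definition block_perm (a : 'S_p.+1) : 'S_K :=
  (ext_perm lS_pos_inj a * ext_perm lT_pos_inj a)%g.

Lemma odd_block_perm a : odd_perm (block_perm a) = false.
Proof. by rewrite odd_permM !odd_ext_perm addbb. Qed.

Lemma block_perm_lS (a : 'S_p.+1) c : a ord0 = ord0 ->
  block_perm a (lS_pos c) = lS_pos (a c).
Proof.
move=> a0; rewrite permM ext_permE; case: (unliftP ord0 (a c)) => [i|] ->.
  by rewrite lS_posS ext_perm_out // => b; apply: lT_pos_neqS.
by rewrite lS_pos0 -lT_pos0 ext_permE a0.
Qed.

Lemma block_perm_lT (a : 'S_p.+1) c : a ord0 = ord0 ->
  block_perm a (lT_pos c) = lT_pos (a c).
Proof.
move=> a0; rewrite permM -(ext_permE lT_pos_inj); congr (fun_of_perm _ _).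
case: (unliftP ord0 c) => [i|] ->.
  by rewrite lT_posS ext_perm_out // => b; apply: lS_pos_neqT.
by rewrite lT_pos0 -lS_pos0 ext_permE a0.
Qed.

Lemma perm_neq0 (a : 'S_p.+1) c : a ord0 = ord0 -> (a c != ord0) = (c != ord0).
Proof. by move=> a0; rewrite -{1}a0 (inj_eq perm_inj). Qed.

Lemma zigzag_conj s (a : 'S_p.+1) : a ord0 = ord0 ->
  zigzag (s ^ a)%g = (zigzag s ^ block_perm a)%g.
Proof.
move=> a0; apply/permP => y; rewrite -(permKV (block_perm a) y).
case: (posP ((block_perm a)^-1%g y)) => [c|i]; rewrite permJ.
  by rewrite !block_perm_lT // !zigzag_t block_perm_lS // permJ.
rewrite zigzag_s -lS_posS -lT_posS block_perm_lT // block_perm_lS //.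
by rewrite zigzag_lS // perm_neq0.
Qed.

End Positions.

(** * The sign of a perfect shuffle *)

Section Shuffle.

(** The perfect shuffle, which sends 2i to i and 2i + 1 to p + i.  Removing its
    last two points yields the shuffle for p - 1, whence its sign. *)
Fixpoint shuffle p : 'S_(p.*2) :=
  if p is p'.+1 then
    lift_perm ord_max ord_max (lift_perm ord_max (inord p') (shuffle p'))
  else 1%g.

Lemma val_inord_dbl p : (inord p : 'I_(p.*2).+1) = p :> nat.
Proof. by rewrite inordK // ltnS -addnn leq_addr. Qed.

Lemma odd_shuffle p : odd_perm (shuffle p) = odd 'C(p, 2).
Proof.
elim: p => [|p IH]; first by rewrite odd_perm1.
rewrite /= !odd_lift_perm IH binS bin1 oddD val_inord_dbl /= odd_double.
by case: (odd p); case: (odd 'C(p, 2)).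
Qed.

Lemma shuffleE p (v : 'I_(p.*2)) :
  shuffle p v = (if odd v then p + v./2 else v./2)%N :> nat.
Proof.
elim: p v => [[]//|p IH] v /=.
case: (unliftP ord_max v) => [v1|] ->; last first.
  by rewrite lift_perm_id /= odd_double /= uphalf_double addSn addnn.
rewrite lift_perm_lift !lift_max.
case: (unliftP ord_max v1) => [v2|] ->; last first.
  by rewrite lift_perm_id val_inord_dbl /= odd_double doubleK.
rewrite lift_perm_lift lift_max /= val_inord_dbl /bump IH.
have := ltn_ord v2; rewrite -{1}(odd_double_half v2) => lt.
have h : (v2./2 < p)%N.
  by rewrite -ltn_double (leq_ltn_trans _ lt) // leq_addl.
case: (odd v2) => /=; first by rewrite leq_addr add1n.
by rewrite leqNgt h.
Qed.

End Shuffle.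

(** * The sum over all arrangements *)

Lemma det_row_perm (R : comNzRingType) n (s : 'S_n) (B : 'M[R]_n) :
  \det (row_perm s B) = (-1) ^+ s * \det B.
Proof. by rewrite row_permE det_mulmx det_perm. Qed.

Lemma odd_cast_perm m n (e : m = n) (s : 'S_m) : cast_perm e s = s :> bool.
Proof. by case: n / e; rewrite cast_perm_id. Qed.

Section Arrangements.
Variables (R : numDomainType) (p : nat).
Notation K := (p + p).+1.
Variable N : 'I_K -> 'I_K -> R.
Implicit Types (t : 'S_K).

(** The minor of N with rows l, T and columns l, S, for the arrangement t. *)
Definition arr_det t :=
  \det (\matrix_(i < p.+1, j < p.+1) N (t (lT_pos i)) (t (lS_pos j))).

(** The signed contribution of the arrangement t; the permanent has rows S and
    columns T. *)
Definition arr_term t :=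
  (-1) ^+ t * arr_det t
  * permanent (\matrix_(i < p, j < p) N (t (S_pos i)) (t (T_pos j))).

(** Permutations of the positions of T, and of those of S. *)
Definition tblock (r : 'S_p) : 'S_K := ext_perm (@T_pos_inj p) r.
Definition sblock (r : 'S_p) : 'S_K := ext_perm (@S_pos_inj p) r.

Lemma tblock_t r i : tblock r (T_pos i) = T_pos (r i).
Proof. exact: ext_permE. Qed.
Lemma sblock_s r i : sblock r (S_pos i) = S_pos (r i).
Proof. exact: ext_permE. Qed.
Lemma tblock_s r i : tblock r (S_pos i) = S_pos i.
Proof. by apply: ext_perm_out => j; rewrite eq_sym S_pos_neqT. Qed.
Lemma sblock_t r i : sblock r (T_pos i) = T_pos i.
Proof. by apply: ext_perm_out => j; rewrite S_pos_neqT. Qed.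
Lemma tblock0 r : tblock r ord0 = ord0.
Proof. by apply: ext_perm_out => j; rewrite -lS_pos0 eq_sym lS_pos_neqT. Qed.
Lemma sblock0 r : sblock r ord0 = ord0.
Proof. by apply: ext_perm_out => j; rewrite -lT_pos0 eq_sym lT_pos_neqS. Qed.

Lemma tblock_lT r a : tblock r (lT_pos a) = lT_pos (lift_perm ord0 ord0 r a).
Proof.
case: (unliftP ord0 a) => [i|] ->.
  by rewrite lift_perm_lift !lT_posS tblock_t.
by rewrite lift_perm_id lT_pos0 tblock0.
Qed.
Lemma tblock_lS r a : tblock r (lS_pos a) = lS_pos a.
Proof.
case: (unliftP ord0 a) => [i|] ->; first by rewrite lS_posS tblock_s.
by rewrite lS_pos0 tblock0.
Qed.
Lemma sblock_lS r a : sblock r (lS_pos a) = lS_pos (lift_perm ord0 ord0 r a).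
Proof.
case: (unliftP ord0 a) => [i|] ->.
  by rewrite lift_perm_lift !lS_posS sblock_s.
by rewrite lift_perm_id lS_pos0 sblock0.
Qed.
Lemma sblock_lT r a : sblock r (lT_pos a) = lT_pos a.
Proof.
case: (unliftP ord0 a) => [i|] ->; first by rewrite lT_posS sblock_t.
by rewrite lT_pos0 sblock0.
Qed.

Lemma arr_det_tblock r t : arr_det (tblock r * t)%g = (-1) ^+ r * arr_det t.
Proof.
have -> : (-1) ^+ r = (-1) ^+ (lift_perm ord0 ord0 r) :> R.
  by rewrite odd_lift_perm.
rewrite -det_row_perm; congr (\det _); apply/matrixP => i j.
by rewrite !mxE !permM tblock_lT tblock_lS.
Qed.

Lemma arr_det_sblock r t : arr_det (sblock r * t)%g = (-1) ^+ r * arr_det t.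
Proof.
have -> : (-1) ^+ r = (-1) ^+ (lift_perm ord0 ord0 r) :> R.
  by rewrite odd_lift_perm.
rewrite /arr_det -[in RHS]det_tr -det_row_perm -[in RHS]det_tr.
congr (\det _); apply/matrixP => i j.
by rewrite !mxE !permM sblock_lT sblock_lS.
Qed.

(** All terms of the permanent contribute equally: a permutation r of the
    columns T changes both the sign of t and the sign of the determinant. *)
Lemma sum_arr_perm : \sum_(t : 'S_K) arr_term t =
  p`!%:R * \sum_(t : 'S_K) (-1) ^+ t * arr_det t *
    \prod_i N (t (S_pos i)) (t (T_pos i)).
Proof.
rewrite /arr_term /permanent; under eq_bigr do rewrite mulr_sumr.
rewrite exchange_big /=.
rewrite -card_Sn mulr_natl -sumr_const /=; apply: eq_bigr => r _.
rewrite (reindex_inj (mulgI (tblock r^-1)%g)) /=; apply: eq_bigr => t _.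
rewrite arr_det_tblock odd_permM odd_ext_perm signr_addb odd_permV.
rewrite mulrACA -signr_addb addbb mul1r; congr (_ * _).
by apply: eq_bigr => i _; rewrite mxE !permM tblock_s tblock_t permK.
Qed.

(** Expansion of the determinant. *)
Lemma sum_arr_zigzag :
  \sum_(t : 'S_K) (-1) ^+ t * arr_det t *
    \prod_i N (t (S_pos i)) (t (T_pos i)) =
  \sum_(s : 'S_p.+1) (-1) ^+ s * relabel_sum N (zigzag s).
Proof.
rewrite /arr_det /determinant.
under eq_bigr do rewrite mulr_sumr mulr_suml.
rewrite exchange_big /=; apply: eq_bigr => s _.
rewrite mulr_sumr; apply: eq_bigr => t _.
rewrite mulrCA -!mulrA; congr (_ * _); congr (_ * _).
rewrite big_pos; congr (_ * _); apply: eq_bigr => i _.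
  by rewrite mxE zigzag_t.
by rewrite zigzag_s.
Qed.

(** Only the p! full cycles contribute; they are the conjugates of the rotation
    by the permutations fixing block 0. *)
Lemma sum_full_cycles :
  \sum_(s : 'S_p.+1) (-1) ^+ s * relabel_sum N (zigzag s) =
  p`!%:R * ((-1) ^+ p * relabel_sum N (zigzag (rot_perm p))).
Proof.
pose P0 := [set a : 'S_p.+1 | a ord0 == ord0].
have cardP0 : #|P0| = p`!.
  have -> : P0 = [set a : 'S_p.+1 | perm_on (~: [set ord0]) a].
    apply/setP => a; rewrite !inE; apply/eqP/subsetP => [a0 y|h].
      by rewrite !inE; apply: contraNneq => ->; rewrite a0.
    by apply/eqP; apply: contraTT isT => /h; rewrite !inE eqxx.
  by rewrite cardsE card_perm cardsC1 card_ord.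
rewrite (bigID (mem [set (rot_perm p ^ a)%g | a in P0])) /= addrC big1 ?add0r.
  rewrite big_imset /=; last first.
    by move=> a b; rewrite !inE => /eqP a0 /eqP b0; apply: rot_conj_inj.
  rewrite -cardP0 mulr_natl -sumr_const; apply: eq_bigr => a.
  rewrite inE => /eqP a0; rewrite odd_permJ odd_rot_perm signr_odd.
  by rewrite zigzag_conj // relabel_sum_conj odd_block_perm mul1r.
move=> s ns; have nfull : #|porbit s ord0| != p.+1.
  apply: contraNneq ns => /full_cycle_conj[a a0 ->].
  by apply: imset_f; rewrite inE a0.
have [x /(relabel_sum_even_orbit N) ->] := zigzag_orbit_even nfull.
by rewrite mulr0.
Qed.

(** The cycle l, S_0, T_0, S_1, T_1, ... is the rotation up to a shuffle of the
    positions other than 0. *)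
Lemma zigzag_rot : zigzag (rot_perm p) =
  (rot_perm (p + p) ^
     lift_perm ord0 ord0 (cast_perm (esym (addnn p)) (shuffle p)))%g.
Proof.
set g := lift_perm _ _ _.
have g0 : g ord0 = ord0 by rewrite lift_perm_id.
have gv (v : 'I_(p + p)) : g (lift ord0 v) =
    (if odd v then p + v./2 else v./2).+1%N :> nat.
  rewrite lift_perm_lift lift0; congr _.+1; rewrite cast_permE.
  by rewrite /= shuffleE.
have gs (v : 'I_(p + p)) (i : 'I_p) : v = i.*2 :> nat ->
  g (lift ord0 v) = S_pos i.
  by move=> e; apply: val_inj; rewrite /= gv e odd_double doubleK.
have gt (v : 'I_(p + p)) (i : 'I_p) : v = i.*2.+1 :> nat ->
  g (lift ord0 v) = T_pos i.
  by move=> e; apply: val_inj; rewrite /= gv e /= odd_double /= uphalf_double.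
apply/permP => y; rewrite -(permKV g y) permJ; move: (g^-1%g y) => x {y}.
case: (unliftP ord0 x) => [v|] ->; last first.
  rewrite g0 -{1}lT_pos0 zigzag_t; case: (posnP p) => [p0|p_gt0].
    have rot0 m : m = 0%N -> rot_perm m ord0 = ord0.
      by move=> m0; apply: ord_inj; rewrite rot_permE m0.
    by rewrite rot0 // lS_pos0 rot0 ?p0.
  have pp : (0 < p + p)%N by rewrite addn_gt0 p_gt0.
  rewrite (@rot_perm_nat _ _ (lift ord0 (Ordinal p_gt0))) // lS_posS.
  rewrite (@rot_perm_nat _ _ (lift ord0 (Ordinal pp))) //.
  by rewrite (gs _ (Ordinal p_gt0)).
have ltv := ltn_ord v; have ev := odd_double_half v.
have ltv2 : (v./2 < p)%N.
  rewrite -ltn_double -[p.*2]addnn (leq_ltn_trans _ ltv) //.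
  by rewrite -[leqRHS]ev leq_addl.
(* Even v are sent to S and odd v to T; after T_(p-1) the cycle returns to l. *)
case ov: (odd v) ev => /= ev; last first.
  rewrite (gs v (Ordinal ltv2)) // zigzag_s.
  have lt1 : (v.+1 < p + p)%N.
    by rewrite -ev add0n [leqRHS]addnn ltn_Sdouble.
  rewrite (@rot_perm_nat _ _ (lift ord0 (Ordinal lt1))) //.
  by rewrite (gt _ (Ordinal ltv2)) //= -[in LHS]ev.
rewrite (gt v (Ordinal ltv2)) //= -lT_posS zigzag_t.
case: (ltnP v./2.+1 p) => [lt1|ge1].
  have lt2 : (v.+1 < p + p)%N.
    by rewrite -ev add1n [leqRHS]addnn -doubleS ltn_double.
  rewrite (@rot_perm_nat _ _ (lift ord0 (Ordinal lt1))) // lS_posS.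
  rewrite (@rot_perm_nat _ _ (lift ord0 (Ordinal lt2))) //.
  by rewrite (gs _ (Ordinal lt1)) //= -[in LHS]ev.
have e1 : v./2.+1 = p by apply/eqP; rewrite eqn_leq ltv2.
have -> : lift ord0 (Ordinal ltv2) = ord_max by apply: ord_inj; rewrite lift0.
have -> : lift ord0 v = ord_max.
  by apply: ord_inj; rewrite lift0 /= -ev add1n -doubleS e1 -addnn.
by rewrite !rot_perm_max lS_pos0 g0.
Qed.

Theorem sum_arr_term : \sum_(t : 'S_K) arr_term t =
  (p`! * p`!)%:R * (-1) ^+ (p + 'C(p, 2)) * relabel_sum N (rot_perm (p + p)).
Proof.
rewrite sum_arr_perm sum_arr_zigzag sum_full_cycles zigzag_rot relabel_sum_conj.
rewrite odd_lift_perm odd_cast_perm odd_shuffle /= signr_odd natrM exprD.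
by rewrite -!mulrA.
Qed.

End Arrangements.

(** * The sign of a sorting permutation *)

Lemma incr_perm_id n (s : 'S_n) : {homo s : i j / (i < j)%N} -> s = 1%g.
Proof.
move=> hs; apply/permP => i; rewrite perm1; apply: val_inj.
have srt : sorted ltn [seq val (s j) | j <- enum 'I_n].
  rewrite sorted_map; apply: (@sub_sorted _ (relpre val ltn)) => [x y /hs//|].
  by rewrite -sorted_map val_enum_ord iota_ltn_sorted.
have : [seq val (s j) | j <- enum 'I_n] = [seq val j | j <- enum 'I_n].
  apply: (irr_sorted_eq ltn_trans ltnn) => //.
    by rewrite val_enum_ord iota_ltn_sorted.
  move=> x; apply/mapP/mapP => -[j _ ->].
    by exists (s j); rewrite ?mem_enum.
  by exists (s^-1%g j); rewrite ?mem_enum ?permKV.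
move/eq_in_map/(_ i); rewrite mem_enum; exact.
Qed.

(** If s lists e (q 0), e (q 1), ... with e increasing, then q^-1 sorts s. *)
Lemma sort_signE (R : nzRingType) m x0 (s : seq 'I_m) r
    (e : 'I_r -> 'I_m) (q : 'S_r) :
  size s = r -> {homo e : i j / (i < j)%N} ->
  (forall i : 'I_r, nth x0 s i = e (q i)) -> sort_sign R s = (-1) ^+ q.
Proof.
move=> sz; case: r / sz e q => e q he hq.
have tE i : tnth (in_tuple s) i = e (q i).
  by rewrite (tnth_nth x0) hq.
have eI : {mono e : i j / (i < j)%N}.
  move=> i j; case: (ltngtP i j) => [/he//|/he h|/val_inj->];
    last by rewrite ltnn.
  by rewrite ltnNge ltnW.
have srtP (p : 'S_(size s)) :
  sorted ltn [seq val (tnth (in_tuple s) (p i)) | i : 'I_(size s)] =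
    (p == q^-1)%g.
  have -> : [seq val (tnth (in_tuple s) (p i)) | i : 'I_(size s)] =
            [seq val (e ((p * q)%g i)) | i <- enum 'I_(size s)].
    by apply: eq_map => i; rewrite tE permM.
  apply/idP/eqP => [srt|->]; last first.
    rewrite (eq_map (g := fun i => val (e i))); last first.
      by move=> i; rewrite mulVg perm1.
    rewrite sorted_map; apply: (@sub_sorted _ (relpre val ltn)) => [x y /he//|].
    by rewrite -sorted_map val_enum_ord iota_ltn_sorted.
  have /(canRL (mulgK q)) -> : (p * q = 1)%g; last by rewrite mul1g.
  apply: incr_perm_id => i j lt; rewrite -eI.
  have tr : transitive (relpre (fun i => val (e ((p * q)%g i))) ltn).
    by move=> x y z; apply: ltn_trans.
  rewrite sorted_map in srt.
  have := sorted_ltn_nth tr i srt; move=> /(_ (val i) (val j)).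
  by rewrite !inE size_enum_ord !ltn_ord !nth_ord_enum; apply.
rewrite /sort_sign; case: pickP => [p|/(_ q^-1%g)]; rewrite srtP ?eqxx //.
by move/eqP->; rewrite odd_permV.
Qed.

(** * From arrangements to triples of an index and two sets *)

Section Shapes.
Variables (R : numDomainType) (p : nat) (d : 'I_(2 * p.+1)).
Notation K := (p + p).+1.
Notation m := (2 * p.+1)%N.
Variable Nm : 'I_m -> 'I_m -> R.

Lemma card_compl1 : K = m.-1.
Proof. by rewrite mul2n doubleS /= addnn. Qed.

(** The increasing enumeration of the indices other than d. *)
Definition skip (j : 'I_K) : 'I_m := lift d (cast_ord card_compl1 j).

Lemma val_skip j : skip j = bump d j :> nat. Proof. by []. Qed.

Lemma skip_inj : injective skip.
Proof. by move=> i j /lift_inj/cast_ord_inj. Qed.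

Lemma skip_neq j : skip j != d. Proof. by rewrite eq_sym neq_lift. Qed.

Lemma skip_incr : {homo skip : i j / (i < j)%N}.
Proof.
by move=> i j lt; rewrite !val_skip ltnNge leq_bump2 -ltnNge.
Qed.

Lemma skip_surj y : y != d -> exists j, skip j = y.
Proof.
case: (unliftP d y) => [k ->|->]; last by rewrite eqxx.
by exists (cast_ord (esym card_compl1) k); rewrite /skip cast_ordKV.
Qed.

Let N i j := Nm (skip i) (skip j).
Implicit Types t : 'S_K.

(** The triple (l, (S, T)) underlying an arrangement t. *)
Definition shape t : 'I_m * ({set 'I_m} * {set 'I_m}) :=
  (skip (t ord0),
   ([set skip (t (S_pos i)) | i : 'I_p], [set skip (t (T_pos i)) | i : 'I_p])).

(** Reordering S and T independently: these permutations act simply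
    transitively on the arrangements of a given shape, and preserve arr_term. *)
Definition blocks (ab : 'S_p * 'S_p) : 'S_K := (sblock ab.1 * tblock ab.2)%g.

Lemma blocks_s ab i : blocks ab (S_pos i) = S_pos (ab.1 i).
Proof. by rewrite permM sblock_s tblock_s. Qed.
Lemma blocks_t ab i : blocks ab (T_pos i) = T_pos (ab.2 i).
Proof. by rewrite permM sblock_t tblock_t. Qed.
Lemma blocks0 ab : blocks ab ord0 = ord0.
Proof. by rewrite permM sblock0 tblock0. Qed.

Lemma blocks_inj : injective blocks.
Proof.
move=> [a b] [a' b'] e; congr (_, _); apply/permP => i.
  by have /permP/(_ (S_pos i)) := e; rewrite !blocks_s => /S_pos_inj.
by have /permP/(_ (T_pos i)) := e; rewrite !blocks_t => /T_pos_inj.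
Qed.

Lemma arr_term_blocks ab t : arr_term N (blocks ab * t)%g = arr_term N t.
Proof.
case: ab => a b; rewrite /arr_term /blocks -mulgA /=.
rewrite arr_det_sblock arr_det_tblock !odd_permM !odd_ext_perm.
congr (_ * _).
  rewrite !mulrA -!signr_addb; congr ((-1) ^+ nat_of_bool _ * _).
  by case: (odd_perm a); case: (odd_perm b); case: (odd_perm t).
rewrite /permanent (reindex_inj (mulIg b^-1%g)) /= (reindex_inj (mulgI a)) /=.
apply: eq_bigr => r _; rewrite [RHS](reindex_inj (@perm_inj _ a)) /=.
apply: eq_bigr => i _.
by rewrite !mxE !permM sblock_s tblock_s sblock_t tblock_t permKV.
Qed.

Lemma shape_blocks ab t : shape (blocks ab * t)%g = shape t.
Proof.
rewrite /shape permM blocks0; congr (_, (_, _)); apply/setP => y.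
  apply/imsetP/imsetP => -[i _ ->].
    by exists (ab.1 i) => //; rewrite permM blocks_s.
  by exists (ab.1^-1%g i) => //; rewrite permM blocks_s permKV.
apply/imsetP/imsetP => -[i _ ->].
  by exists (ab.2 i) => //; rewrite permM blocks_t.
by exists (ab.2^-1%g i) => //; rewrite permM blocks_t permKV.
Qed.

Lemma same_range_perm (T : finType) q (f g : 'I_q -> T) :
  injective f -> injective g ->
  [set f i | i : 'I_q] = [set g i | i : 'I_q] ->
    exists s : 'S_q, forall i, f i = g (s i).
Proof.
move=> fI gI e; have ex i : exists j, f i = g j.
  have : f i \in [set g i | i : 'I_q] by rewrite -e imset_f.
  by case/imsetP => j _ ->; exists j.
have [h h_E] := fin_all_exists ex.
have hI : injective h by move=> i j /(congr1 g); rewrite -!h_E => /fI.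
by exists (perm hI) => i; rewrite permE h_E.
Qed.

Lemma shape_eq t t0 : shape t = shape t0 -> exists ab, t = (blocks ab * t0)%g.
Proof.
move=> e; have /skip_inj t00 : skip (t ord0) = skip (t0 ord0) := congr1 fst e.
have /same_range_perm-[||a ha] := congr1 (fun x => x.2.1) e.
- by move=> i j /skip_inj/perm_inj/S_pos_inj.
- by move=> i j /skip_inj/perm_inj/S_pos_inj.
have /same_range_perm-[||b hb] := congr1 (fun x => x.2.2) e.
- by move=> i j /skip_inj/perm_inj/T_pos_inj.
- by move=> i j /skip_inj/perm_inj/T_pos_inj.
exists (a, b); apply/permP => u; rewrite permM.
case: (posP u) => [c|i]; last by rewrite blocks_s /= (skip_inj (ha i)).
case: (unliftP ord0 c) => [i|] ->;
  first by rewrite lT_posS blocks_t /= (skip_inj (hb i)).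
by rewrite lT_pos0 blocks0 t00.
Qed.

Lemma sum_shape t0 : \sum_(t | shape t == shape t0) arr_term N t =
  (p`! * p`!)%:R * arr_term N t0.
Proof.
have -> : \sum_(t | shape t == shape t0) arr_term N t =
  \sum_(t in [set (blocks ab * t0)%g | ab in [set: 'S_p * 'S_p]]) arr_term N t.
  apply: eq_bigl => t; apply/eqP/imsetP => [/shape_eq[ab ->]|[ab _ ->]].
    by exists ab.
  exact: shape_blocks.
rewrite big_imset /=; last by move=> a b _ _ /mulIg/blocks_inj.
have -> : (p`! * p`!)%N = #|[set: 'S_p * 'S_p]|.
  by rewrite cardsT card_prod !card_Sn.
rewrite mulr_natl -sumr_const; apply: eq_bigr => ab _.
exact: arr_term_blocks.
Qed.

Lemma shape_index_pairs t :
  (shape t).1 != d /\ (shape t).2 \in index_pairs d (shape t).1.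
Proof.
rewrite /= skip_neq; split=> //; rewrite inE /=.
have dis i j : i != j -> skip (t i) != skip (t j).
  by rewrite (inj_eq skip_inj) (inj_eq perm_inj).
apply/and5P; split.
- apply/subsetP => _ /imsetP[i _ ->]; rewrite !inE negb_or skip_neq andbT.
  by rewrite dis // -lT_pos0 eq_sym lT_pos_neqS.
- apply/subsetP => _ /imsetP[i _ ->]; rewrite !inE negb_or skip_neq andbT.
  by rewrite dis // -lS_pos0 eq_sym lS_pos_neqT.
- by rewrite card_imset ?card_ord // => i j /skip_inj/perm_inj/S_pos_inj.
- by rewrite card_imset ?card_ord // => i j /skip_inj/perm_inj/T_pos_inj.
rewrite disjoint_sym; apply/pred0P => y /=;
  apply/negbTE/negP => /andP[/imsetP[i _ ->]].
by case/imsetP => j _ /eqP; apply/negP; rewrite dis // eq_sym S_pos_neqT.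
Qed.

Lemma shape_surj l (S T : {set 'I_m}) : l != d -> (S, T) \in index_pairs d l ->
  exists t, [/\ skip (t ord0) = l,
                forall i, skip (t (S_pos i)) = nth d (enum S) i &
                forall i, skip (t (T_pos i)) = nth d (enum T) i].
Proof.
move=> ld; rewrite inE.
move=> /and5P[/= /subsetP sS /subsetP sT /eqP cS /eqP cT dST].
pose s := l :: enum S ++ enum T.
have sz : size s = K by rewrite /= size_cat -!cardE cS cT.
have us : uniq s.
  rewrite /= mem_cat !mem_enum cat_uniq !enum_uniq andbT /=.
  apply/andP; split.
    rewrite negb_or; apply/andP; split; apply/negP.
      by move/sS; rewrite !inE eqxx.
    by move/sT; rewrite !inE eqxx.
  apply/hasPn => y; rewrite !mem_enum => yT.
  by apply/negP => /(disjointFr dST); rewrite yT.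
have nd y : y \in s -> y != d.
  rewrite inE mem_cat !mem_enum => /or3P[/eqP->//|/sS|/sT];
    by rewrite !inE negb_or => /andP[].
have ex (j : 'I_K) : exists y, skip y = nth d s j.
  by apply/skip_surj/nd/mem_nth; rewrite sz.
have [f fE] := fin_all_exists ex.
have fI : injective f.
  move=> i j /(congr1 skip); rewrite !fE => /eqP.
  by rewrite nth_uniq ?sz ?ltn_ord // => /eqP/val_inj.
have szS : size (enum S) = p by rewrite -cardE cS.
exists (perm fI); split=> [|i|i]; rewrite permE fE //=.
  by rewrite nth_cat szS ltn_ord.
by rewrite add0n nth_cat szS ltnNge leq_addr /= addKn.
Qed.

(** The value of arr_term on the arrangement listing S and T increasingly.  The
    first factor is (-1)^l', with l' the rank of l among the indices other than
    d, which is the sign of moving l from the front to its place. *)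
Definition pair_term (l : 'I_m) (S T : {set 'I_m}) : R :=
  (-1) ^+ (l + (l < d)%N).+1 * sort_sign R (enum S ++ enum T)
  * \det (\matrix_(i < p.+1, j < p.+1)
            Nm (nth d (l :: enum T) i) (nth d (l :: enum S) j))
  * permanent (\matrix_(i < p, j < p) Nm (nth d (enum S) i) (nth d (enum T) j)).

Lemma arr_termE t l (S T : {set 'I_m}) : #|S| = p -> #|T| = p ->
  skip (t ord0) = l ->
  (forall i, skip (t (S_pos i)) = nth d (enum S) i) ->
  (forall i, skip (t (T_pos i)) = nth d (enum T) i) ->
  arr_term N t = pair_term l S T.
Proof.
move=> cS cT tl tS tT; rewrite /arr_term /pair_term.
congr (_ * _ * _); last first.
- by congr (permanent _); apply/matrixP => i j; rewrite !mxE /N tS tT.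
- congr (\det _); apply/matrixP => i j; rewrite !mxE /N; congr (Nm _ _).
    case: (unliftP ord0 i) => [i'|] ->; first by rewrite lT_posS tT.
    by rewrite lT_pos0 tl.
  case: (unliftP ord0 j) => [j'|] ->; first by rewrite lS_posS tS.
  by rewrite lS_pos0 tl.
have [q tq] := lift_permP (erefl (t ord0)).
have szS : size (enum S) = p by rewrite -cardE.
have -> : sort_sign R (enum S ++ enum T) = (-1) ^+ q.
  apply: (@sort_signE _ _ d _ _ (fun v => skip (lift (t ord0) v))).
  - by rewrite size_cat -!cardE cS cT.
  - move=> u v lt; apply: skip_incr.
    by rewrite /= ltnNge leq_bump2 -ltnNge.
  move=> v; have -> : lift (t ord0) (q v) = t (lift ord0 v).
    by rewrite [in RHS]tq lift_perm_lift.
  rewrite nth_cat szS.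
  rewrite -(splitK v); case: (split v) => i /=; first by rewrite ltn_ord -tS.
  by rewrite ltnNge leq_addr addKn -tT.
rewrite {1}tq odd_lift_perm /= signr_addb; congr (_ * _).
rewrite -tl signr_odd val_skip /bump; case: (leqP d (t ord0)) => h /=.
  by rewrite add1n ltnNge ltnW //= addn0 !exprS mulrA mulrNN !mul1r.
by rewrite add0n h addn1 !exprS mulrA mulrNN !mul1r.
Qed.

(** The combinatorial identity relating determinants times permanents to cyclic
    products. *)
Theorem sum_pair_term :
  \sum_(l : 'I_m | l != d) \sum_(ST in index_pairs d l) pair_term l ST.1 ST.2 =
  (-1) ^+ (p + 'C(p, 2)) * relabel_sum N (rot_perm (p + p)).
Proof.
have nz : (p`! * p`!)%:R != 0 :> R by rewrite pnatr_eq0 -lt0n muln_gt0 fact_gt0.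
apply: (mulfI nz); rewrite mulrA -sum_arr_term.
rewrite (partition_big shape
           (fun y => (y.1 != d) && (y.2 \in index_pairs d y.1))) /=;
  last by move=> t _; have [-> ->] := shape_index_pairs t.
rewrite (pair_big_dep (fun l => l != d)
           (fun l ST => ST \in index_pairs d l)) /=.
rewrite mulr_sumr; apply: eq_bigr => -[l [S T]] /= /andP[ld ip].
have [t [tl tS tT]] := shape_surj ld ip.
move: (ip); rewrite inE => /and5P[/= _ _ /eqP cS /eqP cT _].
(* The arrangement t represents the fibre of shape over (l, (S, T)). *)
have sh : shape t = (l, (S, T)).
  rewrite /shape tl; congr (_, (_, _)); apply/setP => y; apply/imsetP/idP.
  - by case=> i _ ->; rewrite tS -mem_enum mem_nth // -cardE cS.
  - rewrite -mem_enum => /(nthP d)[i]; rewrite -cardE cS => lt <-.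
    by exists (Ordinal lt) => //; rewrite tS.
  - by case=> i _ ->; rewrite tT -mem_enum mem_nth // -cardE cT.
  - rewrite -mem_enum => /(nthP d)[i]; rewrite -cardE cT => lt <-.
    by exists (Ordinal lt) => //; rewrite tT.
by rewrite -sh sum_shape (arr_termE cS cT tl tS tT).
Qed.

End Shapes.

(** * Coefficients and contractions in the exterior algebra *)

Lemma incr_inj k m (e : 'I_k -> 'I_m) :
  {homo e : i j / (i < j)%N} -> injective e.
Proof.
move=> he a b eab; apply: val_inj; apply/eqP; rewrite eqn_leq.
by apply/andP; split; rewrite leqNgt; apply/negP => /he; rewrite eab ltnn.
Qed.

Section Forms.
Variables (R : comNzRingType) (m : nat).
Local Notation ext := (extalg R m).
Implicit Types (K : {set 'I_m}).

(** The number of elements of K below i, which is the exponent of the sign in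
    dx_i dx_K. *)
Definition below (i : 'I_m) K := (\sum_(j in K) (j < i))%N.

Lemma extD (a b : ext) K : (a + b) K = a K + b K. Proof. by rewrite ffunE. Qed.
Lemma extN (a : ext) K : (- a) K = - a K. Proof. by rewrite ffunE. Qed.
Lemma extZ c (a : ext) K : (c *: a) K = c * a K. Proof. by rewrite ffunE. Qed.
Lemma ext_0 K : (0 : ext) K = 0. Proof. by rewrite ffunE. Qed.
Lemma ext_sum (I : Type) (r : seq I) (P : pred I) (F : I -> ext) K :
  (\sum_(i <- r | P i) F i) K = \sum_(i <- r | P i) F i K.
Proof. by rewrite sum_ffunE. Qed.

Lemma ext1E K : (1 : ext) K = (K == set0)%:R. Proof. by rewrite ffunE. Qed.

Lemma dx_mul (i : 'I_m) (a : ext) K :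
  (dx R i * a) K = if i \in K then (-1) ^+ below i (K :\ i) * a (K :\ i) else 0.
Proof.
rewrite ffunE; case: ifP => iK; last first.
  rewrite big1 // => I IK; rewrite ffunE.
  suff -> : (I == [set i]) = false by rewrite mul0r mulr0.
  by apply: contraFF iK => /eqP eI; rewrite -sub1set -eI.
rewrite (bigD1 [set i]) ?sub1set //= big1 => [|I /andP[_ /negPf nI]];
  last first.
  by rewrite ffunE nI mul0r mulr0.
by rewrite addr0 ffunE eqxx mul1r /crossings big_set1.
Qed.

Lemma below_lift k (e : 'I_k.+1 -> 'I_m) (a : 'I_k.+1) :
  {homo e : i j / (i < j)%N} ->
  below (e a) [set e (lift a b) | b : 'I_k] = a.
Proof.
move=> he; have eI : {mono e : i j / (i < j)%N}.
  move=> i j; case: (ltngtP i j) => [/he//|/he h|/val_inj->];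
    last by rewrite ltnn.
  by rewrite ltnNge ltnW.
have inje := incr_inj he.
rewrite /below big_imset /=; last by move=> i j _ _ /inje/lift_inj.
under eq_bigr => b _ do rewrite eI.
rewrite (eq_bigr (fun b : 'I_k => (b < a)%N : nat)); last first.
  move=> b _; rewrite /= /bump; case: (leqP a b) => h; last by rewrite h.
  by rewrite ltnNge (leq_trans h) ?leq_addl.
rewrite (eq_bigl predT); last by move=> b; rewrite inE.
rewrite -big_mkcond /= -(@big_ord_widen _ _ _ a k (fun=> 1%N)).
  by rewrite sum_nat_const card_ord muln1.
by rewrite -ltnS.
Qed.

(** The weight B i u_0 * B u_0 u_1 * ... of the path from i through u_0, u_1,
    ..., required to end at j. *)
Fixpoint path_weight (B : 'M[R]_m) k (i : 'I_m) : ('I_k -> 'I_m) -> 'I_m -> R :=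
  if k is k'.+1 return ('I_k -> 'I_m) -> 'I_m -> R then
    fun u j =>
      B i (u ord0) * @path_weight B k' (u ord0) (fun b => u (lift ord0 b)) j
  else fun _ j => (i == j)%:R.

Lemma eq_path_weight B k i (u v : 'I_k -> 'I_m) j : u =1 v ->
  path_weight B i u j = path_weight B i v j.
Proof.
elim: k i u v => //= k IH i u v uv; rewrite uv; congr (_ * _).
by apply: IH => b; rewrite uv.
Qed.

(** The matrix of one-forms B diag(dx). *)
Definition dxmx (B : 'M[R]_m) : 'M[ext]_m := \matrix_(i, j) (B i j *: dx R j).

Lemma dxmx_powS B k i j K : ((dxmx B ^+ k.+1) i j) K =
  \sum_(h in K) B i h * ((-1) ^+ below h (K :\ h) * (dxmx B ^+ k) h j (K :\ h)).
Proof.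
rewrite exprS mxE ext_sum [RHS]big_mkcond; apply: eq_bigr => h _.
rewrite mxE -scalerAl extZ dx_mul.
by case: ifP => // _; rewrite mulr0.
Qed.

(** Only paths that visit every index of the monomial exactly once contribute.
    The induction removes the first index of the path, at the cost of the same
    sign in the exterior algebra and in the sign of the permutation. *)
Lemma dxmx_pow_coef B k (e : 'I_k -> 'I_m) i j : {homo e : i j / (i < j)%N} ->
  ((dxmx B ^+ k) i j) [set e a | a : 'I_k] =
  \sum_(s : 'S_k) (-1) ^+ s * path_weight B i (fun a => e (s a)) j.
Proof.
elim: k e i => [|k IH] e i he.
  have -> : [set e a | a : 'I_0] = set0.
    by apply/setP => y; rewrite inE; apply/imsetP => -[[]].
  rewrite expr0 (big_pred1 1%g) => [|s]; last first.
    by apply/esym/eqP/permP => -[].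
  rewrite odd_perm1 mul1r mxE /=; case: (i == j); last by rewrite ext_0.
  by rewrite mulr1n ext1E eqxx.
have inje := incr_inj he.
rewrite dxmx_powS big_imset /=; last by move=> a b _ _ /inje.
rewrite (sum_lift_perm ord0) (eq_bigl predT) => [|a]; last by rewrite inE.
apply: eq_bigr => a _.
have -> : [set e b | b : 'I_k.+1] :\ e a = [set e (lift a b) | b : 'I_k].
  apply/setP => y; rewrite !inE; apply/andP/imsetP => [[ney /imsetP[b _ eb]]|].
    move: ney; rewrite eb; case: (unliftP a b) => [c|] ->; last by rewrite eqxx.
    by exists c.
  by case=> b _ ->; rewrite (inj_eq inje) eq_sym neq_lift imset_f.
rewrite (below_lift a he) IH; last first.
  by move=> b c lt; apply: he; rewrite /= ltnNge leq_bump2 -ltnNge.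
rewrite mulrCA !mulr_sumr; apply: eq_bigr => s _.
rewrite odd_lift_perm /= signr_addb signr_odd lift_perm_id -!mulrA;
  congr (_ * _).
rewrite mulrCA; congr (_ * (_ * _)).
by apply: eq_path_weight => b; rewrite lift_perm_lift.
Qed.

Lemma dxmx_pow_deg B k i j K : #|K| != k -> ((dxmx B ^+ k) i j) K = 0.
Proof.
elim: k i K => [|k IH] i K cK.
  rewrite expr0 mxE; case: (i == j); last by rewrite ext_0.
  by rewrite mulr1n ext1E -cards_eq0 (negPf cK).
rewrite dxmx_powS big1 // => h hK; rewrite IH ?mulr0 //.
by apply: contraNneq cK => <-; rewrite (cardsD1 h) hK.
Qed.

Lemma path_weight_prod B k i (u : 'I_k.+1 -> 'I_m) j :
  path_weight B i u j = B i (u ord0) *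
    (\prod_(a < k) B (u (widen_ord (leqnSn k) a)) (u (lift ord0 a))) *
    (u ord_max == j)%:R.
Proof.
elim: k i u => [|k IH] i u.
  rewrite /= big_ord0 mulr1; congr (_ * (u _ == _)%:R).
  exact: val_inj.
rewrite -[LHS]/(B i (u ord0) *
                path_weight B (u ord0) (fun b => u (lift ord0 b)) j) IH.
rewrite big_ord_recl -!mulrA; congr (_ * (B (u _) _ * (_ * (u _ == _)%:R))).
- exact: val_inj.
- apply: eq_bigr => a _; congr (B (u _) _); exact: val_inj.
- exact: val_inj.
Qed.

Lemma sum_path_weight B k (u : 'I_k.+1 -> 'I_m) :
  \sum_i path_weight B i u i = \prod_(a < k.+1) B (u a) (u (rot_perm k a)).
Proof.
rewrite (bigD1 (u ord_max)) // big1 => [|i /andP[_ /negPf ni]]; last first.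
  by rewrite path_weight_prod eq_sym ni mulr0.
rewrite path_weight_prod eqxx mulr1.
rewrite big_ord_recr /= rot_perm_max [RHS]mulrC addr0; congr (_ * _).
by apply: eq_bigr => a _; rewrite rot_perm_widen.
Qed.

Theorem tr_dxmx_coef B k (e : 'I_k.+1 -> 'I_m) : {homo e : i j / (i < j)%N} ->
  (\tr (dxmx B ^+ k.+1)) [set e a | a : 'I_k.+1] =
  \sum_(s : 'S_k.+1) (-1) ^+ s * \prod_a B (e (s a)) (e (s (rot_perm k a))).
Proof.
move=> he; rewrite /mxtrace ext_sum.
under eq_bigr => i _ do rewrite dxmx_pow_coef //.
rewrite exchange_big; apply: eq_bigr => s _.
by rewrite -mulr_sumr sum_path_weight.
Qed.

(** Contraction with the vector of coordinates v. *)
Definition contract (v : 'I_m -> R) (a : ext) : ext :=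
  [ffun K : {set 'I_m} =>
     \sum_(i | i \notin K) (-1) ^+ below i K * v i * a (i |: K) : R^o].

Lemma belowU1 i h K : h \notin K -> below i (h |: K) = ((h < i) + below i K)%N.
Proof. by move=> hK; rewrite /below big_setU1. Qed.

(** Contraction is an antiderivation. *)
Lemma contract_dx v h (b : ext) :
  contract v (dx R h * b) = v h *: b - dx R h * contract v b.
Proof.
apply/ffunP => K; rewrite extD extN extZ dx_mul ffunE.
case: ifP => hK; last first.
  rewrite subr0 (bigD1 h) ?hK //= dx_mul setU11 setU1K ?hK //.
  rewrite big1 ?addr0 => [|i /andP[iK ih]].
    by rewrite mulrACA -expr2 sqrr_sign mul1r.
  by rewrite dx_mul !inE hK orbF eq_sym (negPf ih) mulr0.
rewrite ffunE [in RHS](bigD1 h) /= ?setD11 // setD1K //.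
rewrite mulrDr !mulrA -expr2 sqrr_sign mul1r opprD addrA subrr sub0r.
rewrite mulr_sumr -sumrN; apply: eq_big => [i|i iK].
  rewrite !inE negb_and negbK orbC; case: eqP => [->|] /=; first by rewrite hK.
  by rewrite orbF andbT.
have ih : i != h by apply: contraNneq iK => ->; rewrite hK.
rewrite dx_mul !inE hK orbT.
have -> : (i |: K) :\ h = i |: (K :\ h).
  by rewrite setDUl; congr (_ :|: _); apply/setDidPl; rewrite disjoints1 inE.
have iKh : i \notin K :\ h by rewrite !inE negb_and iK orbT.
rewrite -{1}(setD1K hK) belowU1 ?setD11 // belowU1 //.
rewrite !exprD; set x := (-1) ^+ below i _; set y := (-1) ^+ below h _.
(* Exactly one of h < i and i < h holds: dx_h and dx_i anticommute. *)
have : (-1) ^+ (h < i)%N * (-1) ^+ (i < h)%N = -1 :> R.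
  by case: (ltngtP i h) ih => [||/val_inj->]; rewrite ?eqxx ?mulr1 ?mul1r.
set p := (-1) ^+ _; set q := (-1) ^+ _ => pq.
transitivity ((p * q) * (y * (x * v i * b (i |: K :\ h))));
  last by rewrite pq mulN1r mulrA.
rewrite !mulrA; congr (_ * _).
by rewrite -!mulrA; congr (_ * _); rewrite [LHS]mulrA [LHS]mulrC -!mulrA.
Qed.

Lemma contractD v (a b : ext) :
  contract v (a + b) = contract v a + contract v b.
Proof.
apply/ffunP => K; rewrite extD !ffunE -big_split; apply: eq_bigr => i _.
by rewrite extD mulrDr.
Qed.

Lemma contractZ v c (a : ext) : contract v (c *: a) = c *: contract v a.
Proof.
apply/ffunP => K; rewrite extZ !ffunE mulr_sumr; apply: eq_bigr => i _.
by rewrite extZ mulrCA.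
Qed.

Lemma contract0 v : contract v 0 = 0.
Proof. by have := contractZ v 0 0; rewrite !scale0r. Qed.

Lemma contract_sum v (I : Type) (r : seq I) (P : pred I) (F : I -> ext) :
  contract v (\sum_(i <- r | P i) F i) = \sum_(i <- r | P i) contract v (F i).
Proof. exact: (big_morph _ (contractD v) (contract0 v)). Qed.

Lemma contract1 v : contract v 1 = 0.
Proof.
apply/ffunP => K; rewrite ffunE ext_0 big1 // => i _.
have /negbTE nz : i |: K != set0 by apply/set0Pn; exists i; rewrite setU11.
by rewrite ext1E nz mulr0.
Qed.

End Forms.

Section OneForms.
Variables (R : numDomainType) (m n : nat) (c : 'I_m -> 'M[R]_n).
Local Notation ext := (extalg R m).

(** The general matrix of one-forms, with coefficient matrix c h on dx_h. *)
Definition form_mx : 'M[ext]_n := \matrix_(i, j) \sum_h c h i j *: dx R h.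
Local Notation w := form_mx.

Lemma dx_form_mx_pow h k i j :
  dx R h * (w ^+ k) i j = (-1) ^+ k *: ((w ^+ k) i j * dx R h).
Proof.
elim: k i j => [|k IH] i j.
  by rewrite expr0 scale1r mxE mulr_natl mulr_natr.
rewrite exprS mxE mulr_sumr mulr_suml scaler_sumr; apply: eq_bigr => l _.
have dw : dx R h * w i l = - (w i l * dx R h).
  rewrite mxE mulr_sumr mulr_suml -sumrN; apply: eq_bigr => g _.
  by rewrite -scalerAr dx_anticomm scalerN -scalerAl.
rewrite mulrA dw mulNr -[in LHS]mulrA IH -scalerAr exprS mulN1r scaleNr.
by rewrite mulrA.
Qed.

Lemma form_mx_comm k i j g l :
  w i j * (w ^+ k) g l = (-1) ^+ k *: ((w ^+ k) g l * w i j).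
Proof.
rewrite [w i j]mxE mulr_suml mulr_sumr scaler_sumr; apply: eq_bigr => h _.
by rewrite -scalerAl dx_form_mx_pow -scalerAr scalerA mulrC -scalerA.
Qed.

(** Cyclicity of the trace holds up to a sign for matrices of odd forms, so an
    even power has a trace equal to its opposite. *)
Lemma tr_form_mx_even k : \tr (w ^+ k.+1.*2) = 0.
Proof.
have e : \tr (w ^+ k.+1.*2) = - \tr (w ^+ k.+1.*2).
  rewrite doubleS [in LHS]exprS [in RHS]exprSr {1}/mxtrace.
  under eq_bigr => i _ do rewrite mxE.
  under eq_bigr => i _ do under eq_bigr => j _ do rewrite form_mx_comm.
  rewrite exchange_big -sumrN; apply: eq_bigr => i _.
  rewrite mxE -sumrN; apply: eq_bigr => j _.
  by rewrite -signr_odd /= odd_double /= expr1 scaleN1r.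
apply/ffunP => K; move/(congr1 (fun a : ext => a K)): e;
  rewrite extN ext_0 => /eqP.
by rewrite -subr_eq0 opprK -mulr2n mulrn_eq0 /= => /eqP.
Qed.

Variable v : 'I_m -> R.
(** The contraction of form_mx with v is minus the identity. *)
Hypothesis cv : \sum_h v h *: c h = - 1%:M.

Lemma contract_form_mx_mul i j (b : ext) :
  contract v (w i j * b) = - ((i == j)%:R *: b) - w i j * contract v b.
Proof.
rewrite mxE !mulr_suml contract_sum.
under eq_bigr => h _ do rewrite -scalerAl contractZ contract_dx scalerBr
  scalerA.
rewrite sumrB; congr (_ - _); last by apply: eq_bigr => h _; rewrite -scalerAl.
rewrite -scaler_suml -scaleNr; congr (_ *: _).
have /matrixP/(_ i j) := cv; rewrite summxE !mxE => <-.
by apply: eq_bigr => h _; rewrite mxE mulrC.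
Qed.

Lemma contract_form_mx_pow k i j : contract v ((w ^+ k) i j) =
  if odd k then - (w ^+ k.-1) i j else 0.
Proof.
elim: k i j => [|k IH] i j.
  rewrite expr0 mxE; case: (i == j); last by rewrite contract0.
  by rewrite mulr1n contract1.
rewrite exprS mxE contract_sum.
under eq_bigr => l _ do rewrite contract_form_mx_mul IH.
rewrite sumrB (bigD1 i) //= big1 => [|l /negPf nl]; last first.
  by rewrite eq_sym nl scale0r oppr0.
rewrite eqxx scale1r addr0; case: k IH => [|k] IH /=.
  by rewrite big1 ?subr0 // => l _; rewrite mulr0.
rewrite negbK; case: (odd k) => /=.
  by rewrite big1 ?subr0 // => l _; rewrite mulr0.
under eq_bigr => l _ do rewrite mulrN.
by rewrite sumrN opprK exprS mxE addNr.
Qed.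

Theorem contract_tr_form_mx k : contract v (\tr (w ^+ k.+1.*2.+1)) = 0.
Proof.
rewrite contract_sum.
under eq_bigr => i _ do rewrite contract_form_mx_pow /= odd_double.
by rewrite sumrN -/(mxtrace _) tr_form_mx_even oppr0.
Qed.

End OneForms.

Lemma below_compl m (i : 'I_m) : below i (~: [set i]) = i.
Proof.
rewrite /below big_mkcond (eq_bigr (fun j : 'I_m => (j < i)%N : nat)) => [|j _].
  rewrite -big_mkcond -(@big_ord_widen _ _ _ i m (fun=> 1%N)) 1?ltnW //.
  by rewrite sum_nat_const card_ord muln1.
by rewrite !inE; case: eqP => // ->; rewrite ltnn.
Qed.

Lemma below_compl2 (R : comNzRingType) m (i j : 'I_m) : i != j ->
  (-1) ^+ i = (-1) ^+ (j < i)%N * (-1) ^+ below i (~: [set i; j]) :> R.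
Proof.
move=> ij; rewrite -exprD -belowU1 ?inE ?eqxx ?orbT //.
rewrite -{1}(below_compl i); congr ((-1) ^+ below _ _); apply/setP => h.
by rewrite !inE; case: eqP => [->|_] /=; rewrite ?orbF ?(negPf ij) ?orbN.
Qed.

(** Coefficientwise, a form of codegree 1 killed by the contraction is
    proportional to sum_i (-1)^i v_i prod_(j != i) dx_j. *)
Lemma contract_codim1 (R : comNzRingType) m (v : 'I_m -> R) (a : extalg R m)
    (d l : 'I_m) :
  l != d -> contract v a = 0 ->
  (-1) ^+ l * v l * a (~: [set d]) = (-1) ^+ d * v d * a (~: [set l]).
Proof.
move=> ld /ffunP/(_ (~: [set l; d])); rewrite ext_0 ffunE.
have dl : d != l by rewrite eq_sym.
have compl i j : i != j :> 'I_m -> i |: ~: [set i; j] = ~: [set j].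
  move=> ij; apply/setP => h.
  by rewrite !inE; case: eqP => [->|_] //=; rewrite ij.
rewrite (eq_bigl (mem [set l; d])); last by move=> i; rewrite !inE negbK.
rewrite big_setU1 ?inE // big_set1 compl // {2 3}setUC compl // => e.
rewrite (below_compl2 _ ld) (below_compl2 _ dl).
have -> : (-1) ^+ (d < l)%N = - (-1) ^+ (l < d)%N :> R.
  by case: (ltngtP d l) ld => [||/val_inj->]; rewrite ?eqxx ?opprK.
rewrite -!mulrA mulNr -mulrN; congr (_ * _); apply/eqP.
by rewrite eq_sym -subr_eq0 opprK !mulrA addrC; apply/eqP.
Qed.

Lemma prod_dx_sorted (R : comNzRingType) m (s : seq 'I_m) :
  sorted ltn (map val s) ->
  forall K, (\prod_(j <- s) dx R j) K = (K == [set j in s])%:R.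
Proof.
elim: s => [|i s IH] /= srt K.
  by rewrite big_nil ext1E; congr ((_ == _)%:R); apply/setP => j; rewrite !inE.
have srt' : sorted ltn (map val s) by apply: path_sorted srt.
have lt j : j \in s -> (i < j)%N.
  by move=> js; have /allP/(_ (val j)) := order_path_min ltn_trans srt; apply;
    rewrite map_f.
have nis : i \notin s by apply/negP => /lt; rewrite ltnn.
rewrite big_cons dx_mul IH //; case: ifP => iK.
  have -> : (K :\ i == [set j in s]) = (K == [set j in i :: s]).
    rewrite set_cons; apply/eqP/eqP => [<-|->]; first by rewrite setD1K.
    by rewrite setU1K // inE.
  case: eqP => [eK|_]; last by rewrite mulr0.
  rewrite mulr1 /below big1 ?expr0 // => j; rewrite eK set_cons setU1K ?inE //.
  by move/lt => h; rewrite ltnNge ltnW.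
suff -> : (K == [set j in i :: s]) = false by [].
by apply: contraFF iK => /eqP->; rewrite !inE eqxx.
Qed.

Lemma prod_dx_compl (R : comNzRingType) m (i : 'I_m) K :
  (\prod_(j < m | j != i) dx R j) K = (K == ~: [set i])%:R.
Proof.
rewrite -big_filter prod_dx_sorted; last first.
  rewrite sorted_map sorted_filter //; first by move=> x y z; apply: ltn_trans.
  by rewrite -sorted_map; have := iota_ltn_sorted 0 m;
    rewrite -val_enum_ord /index_enum -enumT.
by congr ((_ == _)%:R); apply/setP => j;
  rewrite !inE mem_filter mem_index_enum andbT.
Qed.

(** * Determinants and complementary minors *)

Section Minors.
Variable F : comNzRingType.

(** The complementary minor formula for leading blocks.  Replacing the second
    block column of the inverse by (0, 1) turns the product into a block upper
    triangular matrix with diagonal blocks 1 and e. *)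
Lemma mul_block_det n1 n2 (a : 'M[F]_n1) b c (e : 'M_n2) a' b' c' e' :
  block_mx a b c e *m block_mx a' b' c' e' = 1%:M ->
  \det (block_mx a b c e) * \det a' = \det e.
Proof.
rewrite mulmx_block (scalar_mx_block n1 n2 1) => /eq_block_mx[h1 _ h3 _].
have -> : \det a' = \det (block_mx a' 0 c' (1%:M : 'M_n2)).
  by rewrite det_lblock det1 mulr1.
rewrite -det_mulmx mulmx_block !mulmx0 !mulmx1 !add0r h1 h3.
by rewrite det_ublock det1 mul1r.
Qed.

Lemma det_mxsub_bij n1 n2 (g : 'I_n1 -> 'I_n2) (B : 'M[F]_n2) :
  bijective g -> \det (mxsub g g B) = \det B.
Proof.
move=> gb; have e : n1 = n2 by have := bij_eq_card gb; rewrite !card_ord.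
case: n2 / e g B gb => g B /bij_inj gI.
have -> : mxsub g g B = row_perm (perm gI) (col_perm (perm gI) B).
  by apply/matrixP => i j; rewrite !mxE !permE.
rewrite det_row_perm col_permE det_mulmx det_perm mulrCA.
by rewrite odd_permV -signr_addb addbb mulr1.
Qed.

Lemma det_swap_block n :
  \det (block_mx 0 1%:M 1%:M 0 : 'M[F]_(n + n)) = (-1) ^+ n.
Proof.
have -> : block_mx 0 1%:M 1%:M 0 =
  block_mx 1%:M 1%:M 0 1%:M *m block_mx (-1)%:M 0 1%:M 1%:M
  *m block_mx 1%:M (-1)%:M 0 1%:M :> 'M[F]_(n + n).
  rewrite !mulmx_block !(mulmx0, mul0mx, mul1mx, mulmx1, add0r, addr0).
  have -> : (-1)%:M + 1%:M = 0 :> 'M[F]_n by rewrite -raddfD /= addNr raddf0.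
  by rewrite mul0mx add0r.
by rewrite !det_mulmx !det_ublock det_lblock !det1 det_scalar !mulr1 mul1r.
Qed.

End Minors.

Lemma perm_mx_swap (F : comNzRingType) p :
  perm_mx (swap_perm p) = block_mx 0 1%:M 1%:M 0 :> 'M[F]_(p + p).
Proof.
apply/matrixP => i j; rewrite -(splitK i) -(splitK j).
case: (split i) => k; case: (split j) => l /=;
  rewrite ?block_mxEul ?block_mxEur ?block_mxEdl ?block_mxEdr !mxE permE
    ?swap_funl ?swap_funr.
- by rewrite eq_rlshift.
- by rewrite (inj_eq (@rshift_inj _ _)).
- by rewrite (inj_eq (@lshift_inj _ _)).
- by rewrite eq_lrshift.
Qed.

Lemma odd_swap_perm p : odd_perm (swap_perm p) = odd p.
Proof.
have := det_swap_block int p; rewrite -perm_mx_swap det_perm -[RHS]signr_odd.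
by case: (odd_perm _); case: (odd p).
Qed.

(** The upper left block is irrelevant: exchanging the two block columns makes
    the matrix block triangular. *)
Lemma det_block_dr0 (F : comNzRingType) n (E B C : 'M[F]_n) :
  \det (block_mx E (- B) C^T 0) = \det B * \det C.
Proof.
have d1 : \det (block_mx 0 (-1)%:M 1%:M 0 : 'M[F]_(n + n)) = 1.
  have -> : block_mx 0 (-1)%:M 1%:M 0 =
    block_mx 1%:M (-1)%:M 0 1%:M *m block_mx 1%:M 0 1%:M 1%:M
    *m block_mx 1%:M (-1)%:M 0 1%:M :> 'M[F]_(n + n).
    rewrite !mulmx_block !(mulmx0, mul0mx, mul1mx, mulmx1, add0r, addr0).
    have -> : 1%:M + (-1)%:M = 0 :> 'M[F]_n by rewrite -raddfD /= addrN raddf0.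
    have -> : (-1)%:M + 1%:M = 0 :> 'M[F]_n by rewrite -raddfD /= addNr raddf0.
    by rewrite mul0mx add0r.
  by rewrite !det_mulmx !det_ublock det_lblock !det1 !mulr1.
rewrite -[LHS]mulr1 -d1 -det_mulmx mulmx_block.
rewrite !(mulmx0, mul0mx, mulmx1, add0r, addr0) det_ublock !mul_mx_scalar.
by rewrite -scaleN1r !detZ det_tr mulrACA -expr2 sqrr_sign mul1r.
Qed.

Section Jacobi.
Variables (F : comNzRingType) (n : nat) (m : nat).

(** Inclusion of the first two of three blocks of n indices. *)
Definition emb (v : 'I_(n + n)) : 'I_(n + (n + n)) :=
  match split v with
  | inl k => lshift (n + n) k
  | inr k => rshift n (lshift n k)
  end.

(** The injection f of 2n indices, completed by the identity on the n extra
    indices of M. *)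
Definition extr (f : 'I_(n + n) -> 'I_m) (i : 'I_(n + (n + n))) : 'I_(m + n) :=
  match split i with
  | inl k => lshift n (f (lshift n k))
  | inr k => match split k with
             | inl k' => lshift n (f (rshift n k'))
             | inr k' => rshift m k'
             end
  end.

Lemma embl k : emb (lshift n k) = lshift (n + n) k.
Proof. by rewrite /emb (unsplitK (inl k)). Qed.
Lemma embr k : emb (rshift n k) = rshift n (lshift n k).
Proof. by rewrite /emb (unsplitK (inr k)). Qed.

Variant emb_spec : 'I_(n + (n + n)) -> Prop :=
 | EmbIn v : emb_spec (emb v)
 | EmbOut k : emb_spec (rshift n (rshift n k)).

Lemma embP i : emb_spec i.
Proof.
rewrite -(splitK i); case: (split i) => k /=.
  by rewrite -embl; constructor.
by rewrite -(splitK k); case: (split k) => l /=; rewrite -?embr; constructor.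
Qed.

Lemma extr_emb f v : extr f (emb v) = lshift n (f v).
Proof.
rewrite -(splitK v); case: (split v) => k /=; rewrite ?embl ?embr /extr.
  by rewrite (unsplitK (inl k)).
by rewrite (unsplitK (inr (lshift n k))) (unsplitK (inl k)).
Qed.

Lemma extrr f k : extr f (rshift n (rshift n k)) = rshift m k.
Proof. by rewrite /extr (unsplitK (inr (rshift n k))) (unsplitK (inr k)). Qed.

Lemma emb_inj : injective emb.
Proof.
move=> i j; rewrite -(splitK i) -(splitK j).
case: (split i) => k; case: (split j) => l /=; rewrite ?embl ?embr.
- by move/lshift_inj->.
- by move/eqP; rewrite eq_lrshift.
- by move/eqP; rewrite eq_rlshift.
- by move/rshift_inj/lshift_inj->.
Qed.

Lemma emb_out v k : emb v != rshift n (rshift n k).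
Proof.
rewrite -(splitK v); case: (split v) => l /=; rewrite ?embl ?embr.
  by rewrite eq_lrshift.
by rewrite (inj_eq (@rshift_inj _ _)) eq_lrshift.
Qed.

Lemma extr_inj f : injective f -> injective (extr f).
Proof.
move=> fI i j; case: (embP i) => k; case: (embP j) => l;
  rewrite ?extr_emb ?extrr.
- by move/lshift_inj/fI->.
- by move/eqP; rewrite eq_lrshift.
- by move/eqP; rewrite eq_rlshift.
- by move/rshift_inj->.
Qed.

(** The complementary minor formula for M = [[*, -A], [A^T, 0]] and its inverse
    Mi, with rows listed by g and columns by f.  As f and g have the same range,
    the complementary minor of M only involves rows of A. *)
Lemma complementary_minor (f g : 'I_(n + n) -> 'I_m) (h : 'S_(n + n))
    (A : 'M[F]_(m, n)) (M Mi : 'M[F]_(m + n)) :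
  (n + n = m)%N -> injective g -> (forall i, f i = g (h i)) ->
  M *m Mi = 1%:M -> (forall i j, M (lshift n i) (rshift m j) = - A i j) ->
  (forall i j, M (rshift m i) (lshift n j) = A j i) ->
  (forall i j, M (rshift m i) (rshift m j) = 0) ->
  (-1) ^+ h * \det M * \det (\matrix_(i < n, j < n)
     Mi (lshift n (g (lshift n i))) (lshift n (f (lshift n j)))) =
  \det (\matrix_(i < n, j < n) A (f (rshift n i)) j) *
  \det (\matrix_(i < n, j < n) A (g (rshift n i)) j).
Proof.
move=> nm gI fg MMi Mur Mdl Mdr.
have fI : injective f by move=> i j; rewrite !fg => /gI/perm_inj.
have cc : #|'I_(m + n)| = #|'I_(n + (n + n))| by rewrite !card_ord addnA nm.
have gB : bijective (extr g).
  by apply: inj_card_bij (extr_inj gI) _; rewrite cc.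
(* Reorder rows and columns so that both minors become leading blocks. *)
pose M' := mxsub (extr f) (extr g) M.
pose Mi' := mxsub (extr g) (extr f) Mi.
have MM' : M' *m Mi' = 1%:M.
  apply/matrixP => i j; move/matrixP: MMi => /(_ (extr f i) (extr f j)).
  rewrite !mxE (reindex (extr g)) /=; last exact: onW_bij.
  rewrite (inj_eq (extr_inj fI)) => <-.
  by apply: eq_bigr => k _; rewrite !mxE.
have detM' : \det M' = (-1) ^+ h * \det M.
  rewrite -(det_mxsub_bij M gB) -(odd_ext_perm emb_inj h) -det_row_perm.
  congr (\det _); apply/matrixP => i j; rewrite !mxE; congr (M _ _).
  case: (embP i) => k; first by rewrite ext_permE !extr_emb fg.
  by rewrite ext_perm_out ?extrr // => a; apply: emb_out.
rewrite -detM'; move: MM'; rewrite -[M']submxK -[Mi']submxK => /mul_block_det.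
rewrite submxK => e.
have -> : \matrix_(i < n, j < n)
     Mi (lshift n (g (lshift n i))) (lshift n (f (lshift n j))) = ulsubmx Mi'.
  by apply/matrixP => i j; rewrite !mxE -!embl !extr_emb.
rewrite e; set D := drsubmx _.
rewrite -[D]submxK; set AT := \matrix_(i, j) A (f _) j;
  set AS := \matrix_(i, j) A _ j.
have -> : ursubmx D = - AT.
  by apply/matrixP => i j; rewrite !mxE -embr extr_emb extrr Mur.
have -> : dlsubmx D = AS^T.
  by apply/matrixP => i j; rewrite !mxE -embr extr_emb extrr Mdl.
have -> : drsubmx D = 0.
  by apply/matrixP => i j; rewrite !mxE !extrr Mdr.
exact: det_block_dr0.
Qed.

End Jacobi.

(** * The minors of the inverse of M *)

Section Minor.
Variables (R : realType) (p : nat) (d : 'I_(2 * p.+1)).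
Notation n := p.+1.
Notation m := (2 * n)%N.

(** Inclusion of the positions of two lists of length p into those of the lists
    l, S and T, d, in which l comes first and d last. *)
Definition jshift (v : 'I_(p + p)) : 'I_(n + n) :=
  match split v with
  | inl k => lshift n (lift ord0 k)
  | inr k => rshift n (widen_ord (leqnSn p) k)
  end.

Lemma jshiftl k : jshift (lshift p k) = lshift n (lift ord0 k).
Proof. by rewrite /jshift (unsplitK (inl k)). Qed.
Lemma jshiftr k : jshift (rshift p k) = rshift n (widen_ord (leqnSn p) k).
Proof. by rewrite /jshift (unsplitK (inr k)). Qed.

Lemma jshift_inj : injective jshift.
Proof.
move=> i j; rewrite -(splitK i) -(splitK j).
case: (split i) => k; case: (split j) => l /=; rewrite ?jshiftl ?jshiftr.
- by move/lshift_inj/lift_inj->.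
- by move/eqP; rewrite eq_lrshift.
- by move/eqP; rewrite eq_rlshift.
- by move/rshift_inj/(congr1 val) => e; congr (rshift _ _); apply: ord_inj.
Qed.

(** The concatenation of the lists l, S and T, d. *)
Definition rowlist (l : 'I_m) (S T : {set 'I_m}) (i : 'I_(n + n)) : 'I_m :=
  match split i with
  | inl k => nth d (l :: enum S) k
  | inr k => nth d (rcons (enum T) d) k
  end.

Lemma rowlistl l S T k : rowlist l S T (lshift n k) = nth d (l :: enum S) k.
Proof. by rewrite /rowlist (unsplitK (inl k)). Qed.
Lemma rowlistr l S T k :
  rowlist l S T (rshift n k) = nth d (rcons (enum T) d) k.
Proof. by rewrite /rowlist (unsplitK (inr k)). Qed.

Lemma rowlist_nth l (S T : {set 'I_m}) i : #|S| = p ->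
  rowlist l S T i = nth d ((l :: enum S) ++ rcons (enum T) d) i.
Proof.
move=> cS; have sz : size (l :: enum S) = n by rewrite /= -cardE cS.
rewrite nth_cat sz -(splitK i); case: (split i) => k /=.
  by rewrite rowlistl ltn_ord.
by rewrite rowlistr ltnNge leq_addr /= addKn.
Qed.

Lemma rowlist_swap l (S T : {set 'I_m}) i : #|S| = p -> #|T| = p ->
  rowlist l S T i = rowlist l T S (ext_perm jshift_inj (swap_perm p) i).
Proof.
move=> cS cT.
have szS : size (enum S) = p by rewrite -cardE.
have szT : size (enum T) = p by rewrite -cardE.
rewrite -(splitK i); case: (split i) => k /=.
  case: (unliftP ord0 k) => [k'|] ->.
    rewrite -jshiftl ext_permE permE swap_funl jshiftl jshiftr rowlistl
      rowlistr.
    by rewrite nth_rcons szS /= ltn_ord.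
  rewrite ext_perm_out ?rowlistl // => v.
  rewrite -(splitK v); case: (split v) => c /=; rewrite ?jshiftl ?jshiftr.
    by rewrite (inj_eq (@lshift_inj _ _)) eq_sym neq_lift.
  by rewrite eq_rlshift.
case: (unliftP ord_max k) => [k'|] ->.
  have -> : lift ord_max k' = widen_ord (leqnSn p) k'.
    by apply: ord_inj; rewrite lift_max.
  rewrite -jshiftr ext_permE permE swap_funr jshiftl jshiftr rowlistl rowlistr.
  by rewrite nth_rcons szT /= ltn_ord.
rewrite ext_perm_out.
  by rewrite !rowlistr !nth_rcons szS szT /= ltnn eqxx.
move=> v.
rewrite -(splitK v); case: (split v) => c /=; rewrite ?jshiftl ?jshiftr.
  by rewrite eq_lrshift.
rewrite (inj_eq (@rshift_inj _ _)); apply/eqP => /(congr1 val) /= e.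
by have := ltn_ord c; rewrite e ltnn.
Qed.

Lemma rowlist_inj l (S T : {set 'I_m}) : l != d -> (S, T) \in index_pairs d l ->
  injective (rowlist l T S).
Proof.
move=> ld; rewrite inE.
move=> /and5P[/= /subsetP sS /subsetP sT /eqP cS /eqP cT dST].
have us : uniq ((l :: enum T) ++ rcons (enum S) d).
  have lT : l \notin T by apply/negP => /sT; rewrite !inE eqxx.
  have lS : l \notin S by apply/negP => /sS; rewrite !inE eqxx.
  have dT : d \notin T by apply/negP => /sT; rewrite !inE eqxx orbT.
  have dS : d \notin S by apply/negP => /sS; rewrite !inE eqxx orbT.
  rewrite cat_uniq rcons_uniq /= !enum_uniq !mem_enum lT dS /= !andbT.
  apply/hasPn => y; rewrite mem_rcons !inE !mem_enum => /orP[/eqP->|yS].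
    by rewrite eq_sym negb_or ld.
  rewrite negb_or; apply/andP; split; first by apply: contraTneq yS => ->.
  by apply/negP => yT; have := disjointFr dST yS; rewrite yT.
move=> i j; rewrite !rowlist_nth // => /eqP.
have sz : size ((l :: enum T) ++ rcons (enum S) d) = (n + n)%N.
  by rewrite size_cat size_rcons /= -!cardE cS cT.
by rewrite nth_uniq ?sz ?ltn_ord // => /eqP/val_inj.
Qed.

(** The permutation between the lists l, S, T, d and l, T, S, d is a product of
    p transpositions, hence even. *)
Lemma minor_pair (A : 'M[R]_(m, n)) (x : 'rV[R]_m) (Mi : 'M[R]_(m + n)) l
    (S T : {set 'I_m}) :
  ~~ odd p -> Mmx A x *m Mi = 1%:M -> l != d -> (S, T) \in index_pairs d l ->
  Psi A x * \det (\matrix_(i < n, j < n)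
     Mi (lshift n (nth d (l :: enum T) i)) (lshift n (nth d (l :: enum S) j))) =
  \det (A_rows A d S) * \det (A_rows A d T).
Proof.
move=> ep MMi ld ip; move: (ip);
  rewrite inE => /and5P[/= _ _ /eqP cS /eqP cT _].
have nm : (n + n = m)%N by rewrite addnn mul2n.
have := @complementary_minor R n m (rowlist l S T) (rowlist l T S) _ A
  (Mmx A x) Mi nm (rowlist_inj ld ip) (fun i => rowlist_swap l i cS cT) MMi.
rewrite odd_ext_perm odd_swap_perm (negPf ep) mul1r => h.
transitivity (\det (\matrix_(i, j) A (rowlist l S T (rshift n i)) j) *
  \det (\matrix_(i, j) A (rowlist l T S (rshift n i)) j)); last first.
  rewrite mulrC; congr (_ * _); congr (\det _); apply/matrixP => i j;
    by rewrite !mxE rowlistr.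
rewrite -h; first 1 last.
- by move=> i j; rewrite block_mxEur mxE.
- by move=> i j; rewrite block_mxEdl mxE.
- by move=> i j; rewrite block_mxEdr mxE.
congr (_ * _); congr (\det _); apply/matrixP => i j; by rewrite !mxE !rowlistl.
Qed.

End Minor.

(** * The differential of L *)

Section Differential.
Variables (R : realType).

Lemma derive_coord m (x v : 'rV[R]_m) k :
  'D_v (fun y : 'rV[R]_m => y 0 k) x = v 0 k.
Proof.
rewrite /derive; apply: lim_near_cst => //; near=> h.
have h0 : h != 0 by near: h; exact: nbhs_dnbhs_neq.
by rewrite /= !mxE addrK /GRing.scale /= mulrA mulVf // mul1r.
Unshelve. all: by end_near. Qed.

Lemma derivable_coord m (x v : 'rV[R]_m) k :
  derivable (fun y : 'rV[R]_m => y 0 k) x v.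
Proof. exact/diff_derivable/differentiable_coord. Qed.

Lemma derive_Lmx n (A : 'M[R]_(2 * n, n)) (x v : 'rV[R]_(2 * n)) i j :
  (forall k, x 0 k != 0) ->
  'D_v (fun y => Lmx A y i j) x =
  - \sum_k A k i * (v 0 k * (x 0 k) ^- 2) * A k j.
Proof.
move=> x0.
have -> : (fun y => Lmx A y i j) =
  \sum_(k < 2 * n) ((A k i * A k j) \*: (fun y : 'rV[R]_(2 * n) => (y 0 k)^-1)).
  apply/funext => y; rewrite fct_sumE mxE; apply: eq_bigr => k _.
  by rewrite mul_mx_diag !mxE /GRing.scale /= mulrAC.
have dV k : derivable (fun y : 'rV[R]_(2 * n) => (y 0 k)^-1) x v.
  exact/derivableV/derivable_coord.
rewrite derive_sum => [|k]; last exact/derivableZ/dV.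
rewrite -sumrN; apply: eq_bigr => k _.
rewrite deriveZ // deriveV //; last exact: derivable_coord.
rewrite derive_coord /GRing.scale /= mulNr mulrN; congr (- _).
by rewrite [RHS]mulrAC (mulrC (v 0 k)).
Qed.

End Differential.

(** * The form beta as a trace of matrices of size 2n *)

Section TraceShift.
Variables (R : comNzRingType) (m n : nat).
Local Notation ext := (extalg R m).

Lemma mulmx_powS k1 k2 (P : 'M[ext]_(k1, k2)) (Q : 'M[ext]_(k2, k1)) k :
  (P *m Q) ^+ k.+1 = P *m (Q *m P) ^+ k *m Q.
Proof.
elim: k => [|k IH]; first by rewrite expr1 expr0 mulmx1.
by rewrite exprS IH [in RHS]exprS /GRing.mul /= !mulmxA.
Qed.

Lemma in_alg_mxl k1 k2 (B : 'M[R]_(k1, k2)) i j (a : ext) :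
  map_mx (in_alg ext) B i j * a = B i j *: a.
Proof. by rewrite mxE /= mulr_algl. Qed.

Lemma in_alg_mxr k1 k2 (B : 'M[R]_(k1, k2)) i j (a : ext) :
  a * map_mx (in_alg ext) B i j = B i j *: a.
Proof. by rewrite mxE /= mulr_algr. Qed.

Lemma tr_in_alg_mul k1 k2 (X : 'M[ext]_(k1, k2)) (B : 'M[R]_(k2, k1)) :
  \tr (X *m map_mx (in_alg ext) B) = \tr (map_mx (in_alg ext) B *m X).
Proof.
rewrite /mxtrace; under eq_bigr => i _ do rewrite mxE.
under [RHS]eq_bigr => i _ do rewrite mxE.
rewrite exchange_big; apply: eq_bigr => j _; apply: eq_bigr => i _.
by rewrite in_alg_mxl in_alg_mxr.
Qed.

End TraceShift.

Section Beta.
Variables (R : realType) (n : nat) (A : 'M[R]_(2 * n, n)) (x : 'rV[R]_(2 * n)).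
Notation m := (2 * n)%N.
Hypothesis rA : \rank A = n.
Hypothesis x_gt0 : forall i, 0 < x 0 i.

Let D := diag_mx (\row_i (x 0 i)^-1).
Let L := Lmx A x.
Let Li := invmx L.

Lemma x_neq0 i : x 0 i != 0. Proof. by rewrite gt_eqF. Qed.

(** L is positive definite. *)
Lemma Lmx_unit : L \in unitmx.
Proof.
rewrite -row_free_unit; apply: inj_row_free => v vL0.
have AT : row_free A^T by rewrite /row_free mxrank_tr rA.
suff h : v *m A^T = 0 by apply: (row_free_inj AT); rewrite mul0mx.
have : (v *m L *m v^T) 0 0 = 0 by rewrite vL0 mul0mx mxE.
have -> : v *m L *m v^T = (v *m A^T) *m D *m (v *m A^T)^T.
  by rewrite trmx_mul trmxK /L /Lmx !mulmxA.
set w := v *m A^T; rewrite mxE.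
have t_ge0 k : 0 <= (w *m D) 0 k * w^T k 0.
  rewrite mul_mx_diag !mxE mulrAC -expr2 mulr_ge0 ?sqr_ge0 // invr_ge0.
  exact: ltW.
move/psumr_eq0P => h0; apply/rowP => k; have := h0 (fun k _ => t_ge0 k) k isT.
rewrite mul_mx_diag !mxE mulrAC -expr2 => /eqP.
by rewrite mulf_eq0 invr_eq0 (negPf (x_neq0 k)) orbF sqrf_eq0 => /eqP.
Qed.

(** The matrix H with beta = tr ((H diag(dx))^k). *)
Definition Hmx : 'M[R]_m := - (D *m A *m Li *m A^T *m D).

(** The inverse of M, obtained by block elimination; its lower right block is
    the inverse of the Schur complement L. *)
Definition Minv : 'M[R]_(m + n) :=
  block_mx (D + Hmx) (D *m A *m Li) (- (Li *m A^T *m D)) Li.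

Lemma diag_mulV : diag_mx x *m D = 1%:M.
Proof.
rewrite mulmx_diag -[1%:M]diag_const_mx; congr diag_mx; apply/rowP => i.
by rewrite !mxE mulfV // x_neq0.
Qed.

Lemma Mmx_mul : Mmx A x *m Minv = 1%:M.
Proof.
have LLi : A^T *m D *m A *m Li = 1%:M by apply: mulmxV Lmx_unit.
rewrite /Mmx /Minv /Hmx mulmx_block !mul0mx !addr0 [RHS]scalar_mx_block.
congr block_mx.
- rewrite mulmxDr diag_mulV mulNmx !mulmxN opprK.
  by rewrite !mulmxA diag_mulV mul1mx addrNK.
- by rewrite !mulmxA diag_mulV mul1mx mulNmx addrN.
- by rewrite mulmxDr mulmxN !mulmxA LLi mul1mx addrN.
- by rewrite !mulmxA LLi.
Qed.

Lemma invmx_Mmx : invmx (Mmx A x) = Minv.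
Proof.
have [Mu _] := mulmx1_unit Mmx_mul.
by rewrite -[LHS]mulmx1 -Mmx_mul mulKmx.
Qed.

Lemma Psi_neq0 : Psi A x != 0.
Proof. by have [+ _] := mulmx1_unit Mmx_mul; rewrite unitmxE unitfE. Qed.

(** The coefficient of dx_k in L^-1 dL. *)
Definition Lcoef (k : 'I_m) : 'M[R]_n :=
  \matrix_(i, j) - ((Li *m A^T) i k * (x 0 k) ^- 2 * A k j).

Lemma dLmxE i j : dLmx A x i j =
  \sum_k (- (A k i * (x 0 k) ^- 2 * A k j)) *: dx R k.
Proof.
rewrite mxE /differential; apply: eq_bigr => k _; congr (_ *: _).
rewrite derive_Lmx; last exact: x_neq0.
rewrite (bigD1 k) //= big1 => [|k' /negPf nk].
  by rewrite mxE !eqxx mul1r addr0.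
by rewrite mxE nk andbF mul0r mulr0 mul0r.
Qed.

Lemma beta_form k : beta A k x = \tr (form_mx Lcoef ^+ k).
Proof.
rewrite /beta; congr (\tr (_ ^+ k)); apply/matrixP => i j; rewrite !mxE.
under eq_bigr => l _ do rewrite dLmxE mxE /= mulr_algl scaler_sumr.
rewrite exchange_big; apply: eq_bigr => h _.
under eq_bigr => l _ do rewrite scalerA.
rewrite -scaler_suml; congr (_ *: _); rewrite !mxE !mulr_suml -sumrN.
by apply: eq_bigr => l _; rewrite !mxE mulrN !mulrA.
Qed.

(** Euler's relation: L is homogeneous of degree -1. *)
Lemma Lcoef_euler : \sum_k x 0 k *: Lcoef k = - 1%:M.
Proof.
have LiL : Li *m (A^T *m D *m A) = 1%:M := mulVmx Lmx_unit.
rewrite -LiL !mulmxA; apply/matrixP => i j.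
rewrite summxE !mxE -sumrN; apply: eq_bigr => k _.
have -> : (x 0 k *: Lcoef k) i j =
    - (x 0 k * ((Li *m A^T) i k * (x 0 k) ^- 2 * A k j)).
  by rewrite [LHS]mxE [Lcoef k i j]mxE mulrN.
have -> : (Li *m A^T *m D) i k = (Li *m A^T) i k * (x 0 k)^-1.
  by rewrite mul_mx_diag [LHS]mxE [in X in _ * X]mxE.
congr (- _); have xk := x_neq0 k; set a := (Li *m A^T) i k.
by field.
Qed.

(** L^-1 dL factors as P Q with Q = D A a matrix of scalars and Q P =
    H diag(dx). *)
Lemma beta_dxmx k : beta A k.+1 x = \tr (dxmx Hmx ^+ k.+1).
Proof.
(* The minus sign of dL goes to P, one factor D to each of P and Q. *)
pose P : 'M[extalg R m]_(n, m) :=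
  \matrix_(i, h) (((- (Li *m A^T *m D)) i h) *: dx R h).
pose Q := D *m A.
have -> : dxmx Hmx = map_mx (in_alg _) Q *m P.
  apply/matrixP => a h; rewrite mxE [RHS]mxE.
  have -> : Hmx = Q *m - (Li *m A^T *m D) by rewrite mulmxN /Q !mulmxA.
  rewrite [X in X *: _]mxE scaler_suml; apply: eq_bigr => l _.
  by rewrite in_alg_mxl [P l h]mxE scalerA.
rewrite beta_form.
have -> : form_mx Lcoef = P *m map_mx (in_alg _) Q.
  apply/matrixP => i j; rewrite mxE [RHS]mxE; apply: eq_bigr => h _.
  rewrite in_alg_mxr [P i h]mxE [Lcoef h i j]mxE scalerA.
  have -> : (- (Li *m A^T *m D)) i h = - ((Li *m A^T) i h * (x 0 h)^-1).
    by rewrite mxE mul_mx_diag [X in - X]mxE [in X in _ * X]mxE.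
  have -> : Q h j = (x 0 h)^-1 * A h j by rewrite /Q mul_diag_mx !mxE.
  congr (_ *: _); have xh := x_neq0 h; set a := (Li *m A^T) i h.
  by field.
by rewrite mulmx_powS tr_in_alg_mul mulmxA [in RHS]exprS.
Qed.

End Beta.

(** * The formula for beta *)

Lemma odd_bin2_even p : ~~ odd p -> odd 'C(p, 2) = odd p./2.
Proof.
move/even_halfK=> {1}<-; rewrite bin2 -doubleMl doubleK; case: p./2 => // r.
by rewrite oddM doubleS /= odd_double andbT.
Qed.

Lemma Omega_compl (R : realType) n (x : 'rV[R]_(2 * n)) (l : 'I_(2 * n)) :
  Omega x (~: [set l]) = (-1) ^+ l * x 0 l.
Proof.
rewrite ext_sum (bigD1 l) //= [X in _ + X]big1 => [|i /negPf nl].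
  by rewrite addr0 extZ prod_dx_compl eqxx mulr1.
rewrite extZ prod_dx_compl (inj_eq (can_inj (@setCK _))) (inj_eq set1_inj).
by rewrite eq_sym nl mulr0.
Qed.

Lemma Omega_deg (R : realType) n (x : 'rV[R]_(2 * n)) (K : {set 'I_(2 * n)}) :
  (forall l, K != ~: [set l]) -> Omega x K = 0.
Proof.
move=> nK; rewrite ext_sum big1 // => i _.
by rewrite extZ prod_dx_compl (negPf (nK i)) mulr0.
Qed.

Section Final.
Variables (R : realType) (p : nat) (d : 'I_(2 * p.+1)).
Notation n := p.+1.
Notation m := (2 * n)%N.
Variables (A : 'M[R]_(m, n)) (x : 'rV[R]_m).
Hypothesis rA : \rank A = n.
Hypothesis x_gt0 : forall i, 0 < x 0 i.
Hypothesis p_gt0 : (0 < p)%N.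

Lemma double_pred : (2 * n - 1 = (p + p).+1)%N.
Proof. by rewrite mul2n doubleS subn1 /= addnn. Qed.

(** By projectivity, beta is determined by its coefficient on the monomial
    omitting dx_d. *)
Lemma beta_Omega :
  beta A (2 * n - 1) x =
  ((-1) ^+ d * beta A (2 * n - 1) x (~: [set d])) *: ((x 0 d)^-1 *: Omega x).
Proof.
have xd := x_neq0 x_gt0 d.
have io : contract (fun i => x 0 i) (beta A (2 * n - 1) x) = 0.
  have -> : (2 * n - 1 = p.-1.+1.*2.+1)%N.
    by rewrite double_pred prednK // addnn.
  rewrite beta_form //.
  by apply: contract_tr_form_mx; apply: Lcoef_euler.
have dg (K : {set 'I_m}) : #|K| != (p + p).+1 -> beta A (2 * n - 1) x K = 0.
  move=> cK; rewrite double_pred beta_dxmx // /mxtrace ext_sum big1 // => i _.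
  by rewrite dxmx_pow_deg.
(* Both sides have degree 2n - 1: only complements of singletons matter. *)
apply/ffunP => K; rewrite !extZ.
case: (pickP (fun l => K == ~: [set l])) => [l /eqP->|nK]; last first.
  rewrite Omega_deg ?mulr0; last by move=> l; rewrite nK.
  apply: dg; apply/eqP => cK.
  have /eqP/cards1P[l El] : #|~: K| = 1%N.
    have := cardsC K; rewrite cK card_ord => e.
    apply/eqP; rewrite -(eqn_add2l (p + p).+1) e.
    by rewrite mul2n doubleS -addnn addn1.
  by have := nK l; rewrite -El setCK eqxx.
rewrite Omega_compl; case: (eqVneq l d) => [->|ld].
  rewrite mulrACA; set b := beta _ _ _ _;
    transitivity ((-1) ^+ d * (-1) ^+ d * b).
    by rewrite -expr2 sqrr_sign mul1r.
  by field.
have := contract_codim1 ld io.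
set bd := beta _ _ _ (~: [set d]); set bl := beta _ _ _ (~: [set l]) => e.
transitivity ((-1) ^+ d * ((-1) ^+ d * x 0 d * bl) / x 0 d).
  rewrite !mulrA -expr2 sqrr_sign mul1r; by field.
by rewrite -e; field.
Qed.

Lemma beta_coef :
  beta A (2 * n - 1) x (~: [set d]) =
  relabel_sum (fun i j => Hmx A x (skip d i) (skip d j)) (rot_perm (p + p)).
Proof.
rewrite double_pred beta_dxmx //.
have -> : ~: [set d] = [set skip d a | a : 'I_(p + p).+1].
  apply/setP => y; rewrite !inE;
    apply/idP/imsetP => [/skip_surj[a <-]|[a _ ->]].
    by exists a.
  exact: skip_neq.
by rewrite tr_dxmx_coef //; apply: skip_incr.
Qed.

Lemma rot_perm_neq (a : 'I_(p + p).+1) : rot_perm (p + p) a != a.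
Proof.
apply/eqP => /(congr1 val) /=; rewrite rot_permE => e.
have := ltn_ord a; rewrite leq_eqVlt => /orP[/eqP ea|lt].
  move: e; rewrite ea modnn => a0.
  by move: ea; rewrite -a0 => -[]/esym/eqP; rewrite addn_eq0 gtn_eqF.
by move: e; rewrite modn_small // => /eqP; rewrite gtn_eqF.
Qed.

Let Nm (i j : 'I_m) : R := Minv A x (lshift n i) (lshift n j).

(** H and the upper left block of M^-1 differ on the diagonal only, and cyclic
    products only involve off-diagonal entries. *)
Lemma relabel_sum_Hmx_Nm :
  relabel_sum (fun i j => Hmx A x (skip d i) (skip d j)) (rot_perm (p + p)) =
  relabel_sum (fun i j => Nm (skip d i) (skip d j)) (rot_perm (p + p)).
Proof.
apply: eq_bigr => t _; congr (_ * _); apply: eq_bigr => u _.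
rewrite /Nm block_mxEul [RHS]mxE [X in X + _]mxE.
rewrite (inj_eq (@skip_inj _ _)) (inj_eq perm_inj) eq_sym.
rewrite (negPf (rot_perm_neq u)).
by rewrite mulr0n add0r.
Qed.

Lemma adjM_sub_perm (S T : {set 'I_m}) :
  permanent (adjM_sub A d x S T) = Psi A x ^+ p *
  permanent (\matrix_(i < p, j < p) Nm (nth d (enum S) i) (nth d (enum T) j)).
Proof.
rewrite /permanent mulr_sumr; apply: eq_bigr => s _.
rewrite -[p in _ ^+ p]card_ord -prodr_const -big_split; apply: eq_bigr => i _.
by rewrite !mxE invmx_Mmx.
Qed.

(** Each term of the formula, in terms of the inverse of M alone. *)
Lemma formula_termE l (S T : {set 'I_m}) : ~~ odd p -> l != d ->
  (S, T) \in index_pairs d l ->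
  (-1) ^+ ((n + 1) %/ 2 + d + l + (l < d)%N) / Psi A x ^+ n
     * sort_sign R (enum S ++ enum T)
     * \det (A_rows A d S) * \det (A_rows A d T)
     * permanent (adjM_sub A d x S T)
  = (-1) ^+ (d + p./2) * pair_term d Nm l S T.
Proof.
move=> ep ld ip; have Mm := Mmx_mul rA x_gt0.
have e := minor_pair ep Mm ld ip.
rewrite adjM_sub_perm -(mulrA _ (\det _) (\det _)) -e /pair_term.
set De := \det _; set Pe := permanent _; set sg := sort_sign _ _.
have Pz := Psi_neq0 rA x_gt0.
have -> : (-1) ^+ ((n + 1) %/ 2 + d + l + (l < d)%N) =
  (-1) ^+ (d + p./2) * (-1) ^+ (l + (l < d)%N).+1 :> R.
  have -> : ((n + 1) %/ 2 = p./2.+1)%N by rewrite addn1 divn2.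
  by rewrite -exprD; congr (_ ^+ _); rewrite addnS -!addnA !addSn; congr _.+1;
    rewrite addnCA.
have Qz : Psi A x ^+ p != 0 by rewrite expf_neq0.
rewrite (exprSr (Psi A x)); set Q := Psi A x ^+ p in Qz *.
set P := Psi A x in Pz *; set s1 := (-1) ^+ (d + _); set s2 := (-1) ^+ _.
by field; rewrite Pz Qz.
Qed.

Theorem beta_formula : ~~ odd p ->
  beta A (2 * n - 1) x =
  \sum_(l : 'I_m | l != d) \sum_(ST in index_pairs d l)
    ((-1) ^+ ((n + 1) %/ 2 + d + l + (l < d)%N) / Psi A x ^+ n
     * sort_sign R (enum ST.1 ++ enum ST.2)
     * \det (A_rows A d ST.1) * \det (A_rows A d ST.2)
     * permanent (adjM_sub A d x ST.1 ST.2))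
    *: ((x 0 d)^-1 *: Omega x).
Proof.
move=> ep.
rewrite beta_Omega beta_coef relabel_sum_Hmx_Nm.
under [RHS]eq_bigr => l _ do rewrite -scaler_suml.
rewrite -scaler_suml; congr (_ *: _).
transitivity ((-1) ^+ (d + p./2) *
   (\sum_(l : 'I_m | l != d) \sum_(ST in index_pairs d l)
      pair_term d Nm l ST.1 ST.2)).
  have sg : (-1) ^+ (p + 'C(p, 2)) = (-1) ^+ p./2 :> R.
    by rewrite -signr_odd oddD odd_bin2_even // (negPf ep) signr_odd.
  by rewrite sum_pair_term sg exprD -mulrA signrMK.
rewrite mulr_sumr; apply: eq_bigr => l ld.
rewrite mulr_sumr; apply: eq_bigr => -[S T] ip.
by rewrite -formula_termE.
Qed.

End Final.

Theorem theorem7p1 (R : realType) (n : nat) (d : 'I_(2 * n))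
    (A : 'M[R]_(2 * n, n)) (x : 'rV[R]_(2 * n)) :
  (3 <= n)%N -> odd n -> \rank A = n -> (forall i, 0 < x 0 i) ->
  beta A (2 * n - 1) x =
  \sum_(l : 'I_(2 * n) | l != d) \sum_(ST in index_pairs d l)
    ((-1) ^+ ((n + 1) %/ 2 + d + l + (l < d)%N) / Psi A x ^+ n
     * sort_sign R (enum ST.1 ++ enum ST.2)
     * \det (A_rows A d ST.1) * \det (A_rows A d ST.2)
     * permanent (adjM_sub A d x ST.1 ST.2))
    *: ((x 0 d)^-1 *: Omega x).
Proof.
case: n d A x => // p d A x p2 op rA x_gt0.
by apply: beta_formula => //; apply: ltnW p2.
Qed.
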